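(* Let $\theta\in\mathcal D$, let $u_j=S_{f_j}(\theta)\in U$ ($j=1,\dots,J$), $u=(u_1,\dots,u_J)$, and let $F:\mathcal D\to L^2(\Omega\times\Omega)$, $F(\theta)=\mathrm{Cov}_J(u,u)$, be the parameter-to-covariance map. The Hilbert space adjoint of the linearized parameter-to-covariance map $F'(\theta)$, on the cone $\mathcal Y^{cov}$, is $$F'(\theta)^*:\mathcal Y^{cov}\to X,\qquad F'(\theta)^*y=-2\,I_X\,\mathrm{Re}\int_\Omega B_1^{cov}(u,x')^\star\,\Psi(\cdot,x')\,dx',$$ i.e. $(F'(\theta)h,y)_{L^2(\Omega\times\Omega)}=(h,F'(\theta)^*y)_X$ for all $h\in X$, $y\in\mathcal Y^{cov}$, where for a.e. $x'\in\Omega$ $$B_1^{cov}(u,x'):=B\big(\mathrm{Cov}_J(u,u)(\cdot,x')\big)\in\mathcal L(X,W^* ),$$ and $\Psi\in L^2(\Omega;W)$ is the extended adjoint state associated with $y$, i.e. $D(\theta)^\star\Psi(\cdot,x')=y(\cdot,x')$ for a.e. $x'\in\Omega$.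
   Context: Setting. $\Omega$ is a smooth domain. $X$ is a real Hilbert space (parameters), $U$ and $W$ are complex Hilbert spaces of functions on $\Omega$, with Gelfand triples $U\hookrightarrow L^2(\Omega)\hookrightarrow U^*$, $W\hookrightarrow L^2(\Omega)\hookrightarrow W^*$ (dense continuous embeddings, $L^2(\Omega)=L^2(\Omega;\mathbb C)$), and $X$ likewise forms a Gelfand triple with a suitable pivot space. Dual pairings are the canonical complex ones (linear in the first, conjugate-linear in the second argument), extending the $L^2$ inner product. The PDE model is affine bilinear: $D(\theta)u:=Ku+B(u)\theta$ with $K\in\mathcal L(U,W^* )$, $B\in\mathcal L(U,\mathcal L(X,W^* ))$, so $D(\theta)\in\mathcal L(U,W^* )$. On a domain $\mathcal D\subseteq X$, $D(\theta)$ is boundedly invertible: $D(\theta)^{-1}\in\mathcal L(W^*,U)$. For $f\in W^*$ the parameter-to-state map is $S_f:\mathcal D\to U$, $S_f(\theta)=D(\theta)^{-1}f$. Sources $f_1,\dots,f_J\in W^*$ are fixed. Sample covariance: for $u=(u_j)_{j=1}^J,\ v=(v_j)_{j=1}^J\in U^J$, $\mathrm{Cov}_J(u,v)(x,x'):=\frac1J\sum_{j=1}^J u_j(x)\overline{v_j(x')}\in L^2(\Omega\times\Omega)$. $A^\star$ denotes the Banach space adjoint with respect to the complex dual pairings: $D(\theta)^\star\in\mathcal L(W,U^* )$; and $B(u)^\star$ is the complex adjoint (with the real space $X$ complexified). The real part of a functional is defined by $\langle h,\mathrm{Re}\,B(u)^\star w\rangle=\mathrm{Re}\langle B(u)h,w\rangle_{W^*,W}$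 for $h\in X$. $I_X:X^*\to X$ is the Riesz isomorphism, $(h,I_X\xi)_X=\langle h,\xi\rangle$. Covariance cone: $\mathcal Y^{cov}:=\{y\in L^2(\Omega\times\Omega): \exists I<\infty,\ y(x,x')=\sum_{i=1}^I y_i(x)\overline{y_i(x')},\ y_i\in L^2(\Omega)\}$. $L^2(\Omega;W)$ is the Bochner space of $\Psi$ with norm $\big(\int_\Omega\|\Psi(\cdot,x')\|_W^2dx'\big)^{1/2}$. *)

(* Defs.v *)
From HB Require Import structures.
From mathcomp Require Import all_boot all_order all_algebra.
From mathcomp Require Import sesquilinear.
From mathcomp Require Import complex.
From mathcomp Require Import all_classical all_reals all_analysis.
From mathcomp Require Import measurable_realfun.

Set Implicit Arguments.
Unset Strict Implicit.
Unset Printing Implicit Defensive.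

Import Order.TTheory GRing.Theory Num.Theory Num.Def.
Import numFieldNormedType.Exports.

Local Open Scope classical_set_scope.
Local Open Scope complex_scope.
Local Open Scope ring_scope.

Lemma real_complexD (R : realType) (x y : R) : (x + y)%:C = x%:C + y%:C.
Proof. exact: rmorphD. Qed.

Lemma real_complexM (R : realType) (x y : R) : (x * y)%:C = x%:C * y%:C.
Proof. exact: rmorphM. Qed.

(* The scalars of the source are moved to the complex scalars of the target by
   a ring morphism [s]: the identity for complex-linear maps, conjugation for
   antilinear maps, and the inclusion of the reals for real-linear maps. *)
Section BoundedSemilinear.
Context {R : realType} {K : numFieldType} (s : {rmorphism K -> R[i]}).
Context (E : normedModType K) (F : normedModType R[i]).

Definition bounded_semilinear (f : E -> F) : Prop :=
  [/\ forall u v, f (u + v) = f u + f v,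
      forall a v, f (a *: v) = s a *: f v &
      exists M : R, forall v, `|v| <= 1 -> `|f v| <= M%:C].

Definition bslin_pred : {pred E -> F} := mem [set f | bounded_semilinear f].

Record bslin := Bslin { bslin_fun :> E -> F; bslinP : bslin_fun \in bslin_pred }.

HB.instance Definition _ := [isSub for bslin_fun].
HB.instance Definition _ := [Choice of bslin by <:].

Lemma bslin_predE f : (f \in bslin_pred) <-> bounded_semilinear f.
Proof. by split=> [/set_mem|/mem_set]. Qed.

Lemma bslin_bounded (f : bslin) : bounded_semilinear f.
Proof. exact/bslin_predE/bslinP. Qed.

Definition mk_bslin (f : E -> F) (fP : bounded_semilinear f) : bslin :=
  Bslin (mem_set fP).

Fact bslin_submod_closed : submod_closed bslin_pred.
Proof.
split.
  apply/bslin_predE; split=> [u v|a v|].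
  - by rewrite -[X in X = _]/(0 : F) -[X in _ = X + _]/(0 : F) addr0.
  - by rewrite -[X in _ = _ *: X]/(0 : F) scaler0.
  - by exists 0 => v _; rewrite normr0 rmorph0.
move=> a f g /bslin_predE[fD fZ [M fM]] /bslin_predE[gD gZ [N gN]].
apply/bslin_predE; split=> [u v|b v|].
- by rewrite !fctE /= fD gD scalerDr addrACA.
- by rewrite !fctE /= fZ gZ scalerDr !scalerA mulrC.
- exists (complex.Re `|a| * M + N) => v v1.
  rewrite !fctE (le_trans (ler_normD _ _))// real_complexD lerD// ?gN//.
  by rewrite normrZ real_complexM RRe_real ?normr_real// ler_wpM2l// fM.
Qed.

HB.instance Definition _ :=
  GRing.isSubmodClosed.Build R[i] (E -> F) bslin_pred bslin_submod_closed.
HB.instance Definition _ := [SubChoice_isSubLmodule of bslin by <:].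

Lemma bslinD (f : bslin) u v : f (u + v) = f u + f v.
Proof. by have [+ _ _] := bslin_bounded f; apply. Qed.

Lemma bslinZ (f : bslin) a v : f (a *: v) = s a *: f v.
Proof. by have [_ + _] := bslin_bounded f; apply. Qed.

Lemma addbslinE (f g : bslin) v : (f + g) v = f v + g v.
Proof. by []. Qed.

Lemma scalebslinE a (f : bslin) v : (a *: f) v = a *: f v.
Proof. by []. Qed.

Lemma bslin0 (f : bslin) : f 0 = 0.
Proof. by rewrite -(scale0r 0) bslinZ rmorph0 scale0r. Qed.

Lemma bslinP0 (f g : bslin) : (forall v, f v = g v) -> f = g.
Proof. by move=> fg; apply/val_inj/funext. Qed.

(* The norm of [F] takes its values in R[i]; its real part is the norm as a
   real number. *)
Definition opnorm (f : bslin) : R :=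
  sup [set complex.Re `|f v| | v in [set v : E | `|v| <= 1]].

Lemma norm_ReK (V : normedModType R[i]) (v : V) : (complex.Re `|v|)%:C = `|v|.
Proof. by rewrite RRe_real// normr_real. Qed.

Lemma opnorm_has_sup (f : bslin) :
  has_sup [set complex.Re `|f v| | v in [set v : E | `|v| <= 1]].
Proof.
split; first by exists (complex.Re `|f 0|), 0 => //=; rewrite normr0.
have [_ _ [M fM]] := bslin_bounded f.
by exists M => _ /= [v v1 <-]; rewrite -lecR norm_ReK fM.
Qed.

Lemma opnorm_ub (f : bslin) v : `|v| <= 1 -> `|f v| <= (opnorm f)%:C.
Proof.
move=> v1; rewrite -norm_ReK lecR; apply: sup_upper_bound.
  exact: opnorm_has_sup.
by exists v.
Qed.

Lemma opnorm_le (f : bslin) (M : R) :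
  (forall v, `|v| <= 1 -> `|f v| <= M%:C) -> opnorm f <= M.
Proof.
move=> fM; apply: ge_sup; first by have [] := opnorm_has_sup f.
by move=> _ [v v1 <-]; rewrite -lecR norm_ReK fM.
Qed.

Lemma opnorm_ge0 (f : bslin) : 0 <= opnorm f.
Proof.
rewrite -lecR (le_trans (normr_ge0 (f 0)))// opnorm_ub// normr0//.
Qed.

Lemma bslin_le (f : bslin) v : `|f v| <= `|s `|v| | * (opnorm f)%:C.
Proof.
have [->|v0] := eqVneq v 0; first by rewrite bslin0 !normr0 rmorph0 normr0 mul0r.
have nv0 : `|v| != 0 by rewrite normr_eq0.
rewrite -{1}(scale1r v) -(mulfV nv0) -scalerA bslinZ normrZ.
apply: ler_wpM2l => //; apply: opnorm_ub.
by rewrite normrZ normfV normr_id mulVf.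
Qed.

Definition bslin_norm (f : bslin) : R[i] := (opnorm f)%:C.

Fact bslin_normD f g : bslin_norm (f + g) <= bslin_norm f + bslin_norm g.
Proof.
rewrite /bslin_norm -real_complexD lecR; apply: opnorm_le => v v1.
by rewrite (le_trans (ler_normD _ _))// real_complexD lerD// opnorm_ub.
Qed.

Fact bslin_normZ (a : R[i]) f : bslin_norm (a *: f) = `|a| * bslin_norm f.
Proof.
have le b (g : bslin) : bslin_norm (b *: g) <= `|b| * bslin_norm g.
  rewrite -(RRe_real (normr_real b)) /bslin_norm -real_complexM lecR.
  apply: opnorm_le => v v1.
  by rewrite real_complexM RRe_real ?normr_real// normrZ ler_wpM2l// opnorm_ub.
apply/eqP; rewrite eq_le le /=.
have [->|a0] := eqVneq a 0.
  by rewrite normr0 mul0r lecR opnorm_ge0.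
rewrite -ler_pdivlMl ?normr_gt0//.
have {1}-> : f = a^-1 *: (a *: f) by rewrite scalerA mulVf// scale1r.
by rewrite (le_trans (le _ _))// normfV.
Qed.

Fact bslin_norm0_eq0 f : bslin_norm f = 0 -> f = 0.
Proof.
move=> f0; apply: bslinP0 => v; apply/eqP; rewrite -normr_le0.
by rewrite (le_trans (bslin_le f v))// -/(bslin_norm f) f0 mulr0.
Qed.

HB.instance Definition _ :=
  Lmodule_isNormed.Build R[i] bslin bslin_normD bslin_normZ bslin_norm0_eq0.

Lemma bslin_normE (f : bslin) : `|f| = (opnorm f)%:C.
Proof. by []. Qed.

End BoundedSemilinear.

HB.instance Definition _ (R : realType) (K : numFieldType)
    (s : {rmorphism K -> R[i]}) (E : normedModType K)
    (F : normedModType R[i]) (f : bslin s E F) :=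
  GRing.isLinear.Build K E F (s \; *:%R) f (fun a u v =>
    eq_trans (bslinD f (a *: u) v) (congr1 (+%R^~ (f v)) (bslinZ f a u))).

Notation CLin := (bslin idfun).
Notation RLin := (bslin (real_complex _)).

(* The dual of [E], realized as bounded antilinear forms [xi], with
   [xi v = <xi, v>], so that the pairing is linear in [xi] and conjugate-linear
   in [v].  For real [E], this is the dual of the complexification of [E], an
   antilinear form on the complexification being determined by its values on
   [E]. *)
Notation dual s E := (bslin (conjC \o s) E (complex _)^o).
Notation cdual E := (bslin (conjC \o idfun) E (complex _)^o).
Notation rdual E := (bslin (conjC \o real_complex _) E (complex _)^o).

Section Operators.
Context {R : realType}.

Section Adjoint.
Context {K : numFieldType} {s : {rmorphism K -> R[i]}}.
Context {E : normedModType K} {W : normedModType R[i]}.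

(* <A^* w, e> is the conjugate of <A e, w>. *)
Definition adjoint_fun (A : bslin s E (cdual W)) (w : W) : E -> (R[i])^o :=
  fun e => conjC (A e w).

Fact adjoint_subproof A w :
  bounded_semilinear (conjC \o s) (adjoint_fun A w).
Proof.
split=> [u v|a v|].
- by rewrite /adjoint_fun bslinD addbslinE rmorphD.
- by rewrite /adjoint_fun bslinZ scalebslinE rmorphM.
- exists (opnorm A * complex.Re `|w|) => v v1.
  rewrite /adjoint_fun norm_conjC real_complexM norm_ReK mulrC.
  rewrite (le_trans (bslin_le (A v) w))//.
  rewrite /= norm_conjC normr_id ler_wpM2l// -bslin_normE.
  exact: opnorm_ub.
Qed.

Definition adjoint (A : bslin s E (cdual W)) (w : W) : dual s E :=
  mk_bslin (adjoint_subproof A w).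

End Adjoint.

Section Model.
Context {U W : normedModType R[i]} {X : normedModType R}.
Context (K : CLin U (cdual W)) (B : CLin U (RLin X (cdual W))).

Definition model_fun (theta : X) : U -> cdual W := fun u => K u + B u theta.

Fact model_subproof theta : bounded_semilinear idfun (model_fun theta).
Proof.
split=> [u v|a v|].
- by rewrite /model_fun !bslinD addbslinE addrACA.
- by rewrite /model_fun !bslinZ scalebslinE scalerDr.
- exists (opnorm K + `|theta| * opnorm B) => v v1.
  rewrite real_complexD (le_trans (ler_normD _ _))// lerD//.
    exact: opnorm_ub.
  rewrite (le_trans (bslin_le (B v) theta))// real_complexM.
  rewrite ger0_norm ?ler0c// ler_wpM2l ?ler0c// -bslin_normE.
  exact: opnorm_ub.
Qed.

Definition model (theta : X) : CLin U (cdual W) := mk_bslin (model_subproof theta).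

End Model.

Definition boundedly_invertible (U V : normedModType R[i]) (A : CLin U V) :=
  exists A' : CLin V U, cancel A A' /\ cancel A' A.

(* The value A^-1 f for A = model K B theta, when A is invertible. *)
Definition state (U W : normedModType R[i]) (X : normedModType R)
    (K : CLin U (cdual W)) (B : CLin U (RLin X (cdual W)))
    (f : cdual W) (theta : X) : U :=
  get [set u | model K B theta u = f].

Definition Re_form (X : normedModType R) (xi : rdual X) : X -> R :=
  fun h => complex.Re (xi h).

Definition riesz (X : normedModType R) (ip : X -> X -> R) (xi : X -> R) : X :=
  get [set z | forall h, ip h z = xi h].

Definition hilbert_ip (K : numFieldType) (theta : K -> K) (E : normedModType K)
    (ip : {dot E for theta}) : Prop :=
  forall u, ip u u = `|u| ^+ 2.

End Operators.

Section LebesgueRow.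
Context {R : realType}.

HB.instance Definition _ d :=
  Measurable.copy 'rV[R]_d (g_sigma_algebraType (@open 'rV[R]_d)).

Lemma open_measurable_rV d (A : set 'rV[R]_d) : open A -> measurable A.
Proof. by move=> oA; exact: sub_sigma_algebra. Qed.

Lemma measurable_coord d i :
  measurable_fun setT (fun x : 'rV[R]_d => (x 0 i : measurableTypeR R)).
Proof.
apply: (@measurability _ _ _ (measurableTypeR R) _ _ _ (RGenOpens.measurableE R)) => _ [B [a [b ->]] <-].
rewrite setTI; apply: open_measurable_rV.
have /continuousP : continuous (fun x : 'rV[R]_d => x 0 i).
  exact: coord_continuous.
apply; exact: interval_open.
Qed.

Lemma measurable_rVP disp (T : measurableType disp) d (f : T -> 'rV[R]_d) :
  (forall i, measurable_fun setT (fun t => f t 0 i : measurableTypeR R)) ->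
  measurable_fun setT f.
Proof.
move=> mf; apply: (@measurability _ _ _ _ _ _ (@open 'rV[R]_d)) => //.
move=> _ [A oA <-]; rewrite setTI.
pose C (p : 'rV[rat]_d * nat) : set 'rV[R]_d :=
  [set x | forall i, `|x 0 i - ratr (p.1 0 i)| < p.2.+1%:R^-1].
have mC p : measurable (f @^-1` C p).
  have -> : f @^-1` C p = \bigcap_(i in [set: 'I_d])
      ((fun t => f t 0 i) @^-1` ball (ratr (p.1 0 i) : R) p.2.+1%:R^-1).
    apply/seteqP; split=> [t Ct i _|t Ct i].
      by rewrite /ball /= distrC; exact: Ct.
    by have := Ct i Logic.I; rewrite /ball /= distrC.
  apply: fin_bigcap_measurable => [|i _]; first exact: finite_finset.
  rewrite -[X in measurable X]setTI.
  apply: mf => //; apply: open_measurable; exact: ball_open.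
have -> : f @^-1` A = \bigcup_n
    (if unpickle n is Some p then
       if `[< C p `<=` A >] then f @^-1` C p else set0
     else set0).
  apply/seteqP; split=> [t /= Aft|t [n _]]; last first.
    by case: unpickle => // p; case: asboolP => // CA /CA.
  have /nbhs_ballP[e /= e0 eA] := oA _ Aft.
  have [k] : exists k, 0 + k.+1%:R^-1 < e / 2.
    by apply: ltr_add_invr; rewrite divr_gt0.
  rewrite add0r => ke.
  have k0 : (0 : R) < k.+1%:R^-1 by rewrite invr_gt0.
  have /choice[q hq] : forall i, exists q : rat,
      `|f t 0 i - ratr q| < k.+1%:R^-1.
    move=> i.
    have /rat_in_itvoo[q] : f t 0 i - k.+1%:R^-1 < f t 0 i + k.+1%:R^-1.
      by rewrite ltrD2l (lt_trans _ k0)// oppr_lt0.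
    rewrite in_itv /= => /andP[q1 q2]; exists q.
    by rewrite ltr_distlC; apply/andP; split; rewrite ?q1 ?q2.
  pose p := (\row_i q i, k); exists (pickle p) => //.
  rewrite pickleK; case: asboolP => [_ i|[]]; first by rewrite mxE hq.
  move=> y Cy; apply: eA; split=> // i j; rewrite (ord1 i) /ball /=.
  rewrite (le_lt_trans (ler_distD (ratr (q j)) _ _))// (splitr e) ltrD//.
    by rewrite (lt_trans (hq j)).
  by rewrite distrC (lt_trans _ ke)//; have := Cy j; rewrite mxE.
apply: bigcupT_measurable => n.
by case: unpickle => // p; case: asboolP.
Qed.

Definition rV_cons d (p : measurableTypeR R * 'rV[R]_d) : 'rV[R]_d.+1 :=
  \row_i (if unlift ord0 i is Some j then p.2 0 j else p.1).

Definition rV_uncons d (x : 'rV[R]_d.+1) : measurableTypeR R * 'rV[R]_d :=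
  (x 0 ord0, \row_j x 0 (lift ord0 j)).

Lemma rV_consK d : cancel (@rV_cons d) (@rV_uncons d).
Proof.
move=> [a x]; rewrite /rV_uncons mxE unlift_none /=; congr (_, _).
by apply/rowP => j; rewrite !mxE liftK.
Qed.

Lemma measurable_rV_cons d : measurable_fun setT (@rV_cons d).
Proof.
apply: measurable_rVP => i; under eq_fun do rewrite mxE.
case: (unliftP ord0 i) => [j _|_]; last exact: measurable_fst.
exact: (measurableT_comp (measurable_coord j) measurable_snd).
Qed.

Lemma measurable_rV_uncons d : measurable_fun setT (@rV_uncons d).
Proof.
apply/measurable_fun_pairP; split; first exact: measurable_coord.
apply: measurable_rVP => i /=; under eq_fun do rewrite mxE.
exact: measurable_coord.
Qed.

Section Step.
Context (d : nat) (m : {sigma_finite_measure set 'rV[R]_d -> \bar R}).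

Definition lebesgue_rV_step : set 'rV[R]_d.+1 -> \bar R :=
  pushforward (@lebesgue_measure R \x m)%E (@rV_cons d).

Let mcons A : measurable A -> measurable (@rV_cons d @^-1` A).
Proof.
by move=> mA; rewrite -[X in measurable X]setTI; exact: measurable_rV_cons.
Qed.

Let step0 : lebesgue_rV_step set0 = 0%E.
Proof. by rewrite /lebesgue_rV_step /pushforward preimage_set0 measure0. Qed.

Let step_ge0 A : (0 <= lebesgue_rV_step A)%E.
Proof. exact: (measure_ge0 (@lebesgue_measure R \x m)%E). Qed.

Let step_sigma_additive : semi_sigma_additive lebesgue_rV_step.
Proof.
move=> F mF tF mUF; rewrite /lebesgue_rV_step /pushforward preimage_bigcup.
apply: measure_semi_sigma_additive.
- by move=> n; exact: mcons.
- apply/trivIsetP => /= i j _ _ ij; rewrite -preimage_setI.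
  by move/trivIsetP : tF => /(_ _ _ _ _ ij) ->//; rewrite preimage_set0.
- by rewrite -preimage_bigcup; exact: mcons.
Qed.

HB.instance Definition _ := isMeasure.Build _ _ _ lebesgue_rV_step
  step0 step_ge0 step_sigma_additive.

Let step_sigma_finite : sigma_finite setT lebesgue_rV_step.
Proof.
have [F TF mF] := sigma_finiteT (@lebesgue_measure R).
have [G TG mG] := sigma_finiteT m.
pose H n : set 'rV[R]_d.+1 :=
  if unpickle n is Some (i, j) then @rV_uncons d @^-1` (F i `*` G j) else set0.
exists H.
  apply/esym/seteqP; split=> // x _.
  have [i _ Fi] : (\bigcup_i F i) (rV_uncons x).1 by rewrite -TF.
  have [j _ Gj] : (\bigcup_j G j) (rV_uncons x).2 by rewrite -TG.
  by exists (pickle (i, j)) => //; rewrite /H pickleK.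
move=> n; rewrite /H; case: unpickle => [[i j]|]; last first.
  by rewrite measure0.
have [mFi Fi] := mF i; have [mGj Gj] := mG j.
split.
  rewrite -[X in measurable X]setTI; apply: measurable_rV_uncons => //.
  exact: measurableX.
rewrite /lebesgue_rV_step /pushforward -comp_preimage.
have -> : @rV_uncons d \o @rV_cons d = id by apply/funext => p; exact: rV_consK.
rewrite preimage_id product_measure1E//.
by rewrite lte_mul_pinfty// ge0_fin_numE.
Qed.

HB.instance Definition _ :=
  Measure_isSigmaFinite.Build _ _ _ lebesgue_rV_step step_sigma_finite.

End Step.

Fixpoint lebesgue_rV (d : nat) : {sigma_finite_measure set 'rV[R]_d -> \bar R} :=
  if d is d'.+1 then lebesgue_rV_step (lebesgue_rV d')
  else \d_(0 : 'rV[R]_0).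

End LebesgueRow.

Lemma lebesgue_rV_box (R : realType) d (a b : 'rV[R]_d) :
  (forall i, a 0 i <= b 0 i) ->
  lebesgue_rV d [set x | forall i, a 0 i <= x 0 i <= b 0 i] =
    (\prod_(i < d) (b 0 i - a 0 i))%:E.
Proof.
elim: d a b => [|d IH] a b ab.
  rewrite big_ord0 /= diracE mem_set// => -[]//.
rewrite /= /lebesgue_rV_step /pushforward.
have -> : @rV_cons R d @^-1` [set x | forall i, a 0 i <= x 0 i <= b 0 i] =
   (`[a 0 ord0, b 0 ord0]%classic : set (measurableTypeR R)) `*`
   [set x : 'rV[R]_d | forall i, (rV_uncons a).2 0 i <= x 0 i <= (rV_uncons b).2 0 i].
  apply/seteqP; split=> [[t x] /= H|[t x] /= [t1 H] i].
    split; first by have := H ord0; rewrite mxE unlift_none /= in_itv.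
    by move=> i; have := H (lift ord0 i); rewrite !mxE liftK.
  rewrite mxE; case: (unliftP ord0 i) => [j ->|->].
    by have := H j; rewrite !mxE.
  by move: t1; rewrite /= in_itv.
rewrite product_measure1E//.
- rewrite IH ?big_ord_recl ?EFinM; last by move=> i; rewrite !mxE.
  congr (_ * _)%E.
    rewrite [LHS](@lebesgue_measure_itv R `[a 0 ord0, b 0 ord0]) /= lte_fin.
    have := ab ord0; rewrite le_eqVlt => /orP[/eqP->|->//].
    by rewrite ltxx subrr.
  by congr EFin; apply: eq_bigr => i _; rewrite !mxE.
- have -> : [set x : 'rV[R]_d |
      forall i, (rV_uncons a).2 0 i <= x 0 i <= (rV_uncons b).2 0 i] =
    \bigcap_(i in [set: 'I_d]) ((fun x : 'rV[R]_d => x 0 i) @^-1`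
      `[(rV_uncons a).2 0 i, (rV_uncons b).2 0 i]%classic).
    apply/seteqP; split=> [x Hx i _|x Hx i].
      by rewrite /= in_itv /= Hx.
    by have := Hx i Logic.I; rewrite /= in_itv.
  apply: fin_bigcap_measurable => [|i _]; first exact: finite_finset.
  rewrite -[X in measurable X]setTI.
  by apply: measurable_coord => //; exact: measurable_itv.
Qed.

(* Elements of L2 are represented by functions; equality in L2 is equality
   almost everywhere. *)
Section L2.
Context {R : realType} {disp : measure_display} {T : measurableType disp}.
Context (mu : {measure set T -> \bar R}) (D : set T).
Implicit Types f g : T -> R[i].

Definition L2norm f : \bar R :=
  'N[mu]_2[(fun x => (complex.Re `|f x|)%:E) \_ D].

Definition L2 f : Prop :=
  [/\ measurable_fun D (fun x => complex.Re (f x)),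
      measurable_fun D (fun x => complex.Im (f x)) &
      (L2norm f < +oo)%E].

Definition cintegral f : R[i] :=
  (\int[mu]_(x in D) complex.Re (f x)) +i*
  (\int[mu]_(x in D) complex.Im (f x)).

Definition L2ip f g : R[i] := cintegral (fun x => f x * conjC (g x)).

End L2.

Section Embedding.
Context {R : realType} {disp : measure_display} {T : measurableType disp}.
Context (mu : {measure set T -> \bar R}) (D : set T).
Context {U : normedModType R[i]}.

(* A dense continuous embedding of [U] into L2, where [j u] is a
   representative of the class of [u]. *)
Definition L2_dense_embedding (j : U -> T -> R[i]) : Prop :=
  [/\ forall u, L2 mu D (j u),
      forall a u v, {ae mu, forall x, D x ->
        j (a *: u + v) x = a * j u x + j v x},
      exists M : R, forall u, (L2norm mu D (j u) <= (M * complex.Re `|u|)%:E)%E,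
      forall u, {ae mu, forall x, D x -> j u x = 0} -> u = 0 &
      forall g, L2 mu D g -> forall e : R, 0 < e ->
        exists u, (L2norm mu D (fun x => (g x - j u x)%R) < e%:E)%E].

(* The element of [U] whose class is that of [g]; unique by injectivity of the
   embedding, and unspecified if [g] is not in the image of [U]. *)
Definition L2_lift (j : U -> T -> R[i]) (g : T -> R[i]) : U :=
  get [set u | {ae mu, forall x, D x -> j u x = g x}].

End Embedding.

Section Bochner.
Context {R : realType} {disp : measure_display} {T : measurableType disp}.
Context (mu : {measure set T -> \bar R}) (D : set T) {V : normedModType R[i]}.

Definition bsimple (s : T -> V) : Prop :=
  finite_set (s @` D) /\
  forall v, measurable (D `&` s @^-1` [set v]) /\
    (v != 0 -> (mu (D `&` s @^-1` [set v]) < +oo)%E).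

Definition bsimple_integral (s : T -> V) : V :=
  \sum_(v \in s @` D) (fine (mu (D `&` s @^-1` [set v])))%:C *: v.

Definition bsimple_approx (s : nat -> T -> V) (g : T -> V) : Prop :=
  (forall n, bsimple (s n)) /\
  {ae mu, forall x, D x -> s n x @[n --> \oo] --> g x}.

(* [I] is the limit of the integrals of an L1-Cauchy sequence of simple
   functions converging to [g] almost everywhere. *)
Definition is_bochner_integral (g : T -> V) (I : V) : Prop :=
  exists s : nat -> T -> V,
  [/\ bsimple_approx s g,
      forall e : R, 0 < e -> exists N, forall m n, (N <= m)%N -> (N <= n)%N ->
        (\int[mu]_(x in D) (complex.Re `|s m x - s n x|)%:E <= e%:E)%E &
      bsimple_integral (s n) @[n --> \oo] --> I].

Definition bochner_integrable (g : T -> V) : Prop :=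
  exists I, is_bochner_integral g I.

Definition bochner_integral (g : T -> V) : V :=
  get [set I | is_bochner_integral g I].

Definition bochner_L2 (g : T -> V) : Prop :=
  (exists s, bsimple_approx s g) /\
  (\int[mu]_(x in D) ((complex.Re `|g x|) ^+ 2)%:E < +oo)%E.

End Bochner.

Section SmoothDomain.
Context {R : realType}.

Fixpoint Ck (k : nat) d (f : 'rV[R]_d -> R) : Prop :=
  continuous f /\
  if k is k'.+1 then
    forall v, (forall x, derivable f x v) /\ Ck k' (fun x => 'D_v f x)
  else True.

(* Near each boundary point, [Omega] is the strict epigraph of a smooth
   function, in the direction of some signed coordinate axis. *)
Definition smooth_domain d (Omega : set 'rV[R]_d) : Prop :=
  [/\ open Omega, Omega !=set0, connected Omega &
      forall p, closure Omega p -> ~ Omega p ->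
      exists (r : R) (i : 'I_d) (b : bool) (gamma : 'rV[R]_d.-1 -> R),
      [/\ 0 < r, forall k, Ck k gamma &
          forall x, ball p r x ->
            Omega x <-> gamma (col' i x) < (-1) ^+ b * x 0 i]].

End SmoothDomain.

Section Covariance.
Context {R : realType} {disp : measure_display} {T : measurableType disp}.
Context (mu : {sigma_finite_measure set T -> \bar R}) (D : set T).

Definition cov J (u v : 'I_J -> T -> R[i]) (z : T * T) : R[i] :=
  J%:R^-1 * \sum_(j < J) u j z.1 * conjC (v j z.2).

Definition cov_cone (y : T * T -> R[i]) : Prop :=
  L2 (mu \x mu)%E (D `*` D) y /\
  exists (n : nat) (ys : 'I_n -> T -> R[i]),
    (forall i, L2 mu D (ys i)) /\
    {ae (mu \x mu)%E, forall z, (D `*` D) z ->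
      y z = \sum_(i < n) ys i z.1 * conjC (ys i z.2)}.

Section Model.
Context {U W : normedModType R[i]} {X : normedModType R}.
Context (jU : U -> T -> R[i]).
Context (K : CLin U (cdual W)) (B : CLin U (RLin X (cdual W))).

(* [y(., x')] is identified with the form v |-> (y(., x'), v) in the dual of
   [U]. *)
Definition extended_adjoint_state (theta : X) (y : T * T -> R[i])
    (Psi : T -> W) : Prop :=
  bochner_L2 mu D Psi /\
  {ae mu, forall x', D x' -> forall v : U,
    adjoint (model K B theta) (Psi x') v =
      L2ip mu D (fun x => y (x, x')) (jU v)}.

Definition cov_map J (f : 'I_J -> cdual W) (theta : X) : T * T -> R[i] :=
  let u j := jU (state K B (f j) theta) in cov u u.

Definition B1cov J (u : 'I_J -> U) (x' : T) : RLin X (cdual W) :=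
  B (L2_lift mu D jU (fun x => cov (jU \o u) (jU \o u) (x, x'))).

End Model.
End Covariance.

(* [dF] is the Frechet derivative at [theta] of [F : A -> L2], as a bounded
   real-linear map into L2. *)
Definition frechet_L2 {R : realType} {disp : measure_display}
    {T : measurableType disp} (mu : {measure set T -> \bar R}) (D : set T)
    {X : normedModType R} (A : set X) (F : X -> T -> R[i]) (theta : X)
    (dF : X -> T -> R[i]) : Prop :=
  [/\ forall h, L2 mu D (dF h),
      forall a h k, {ae mu, forall x, D x ->
        dF (a *: h + k) x = a%:C * dF h x + dF k x},
      exists M : R, forall h, (L2norm mu D (dF h) <= (M * `|h|)%:E)%E &
      forall e : R, 0 < e -> \forall h \near (0 : X), A (theta + h) ->
        (L2norm mu D (fun x => (F (theta + h) x - F theta x - dF h x)%R)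
           <= (e * `|h|)%:E)%E].

(* Main.v *)
Require Import Defs.
From HB Require Import structures.
From mathcomp Require Import all_boot all_order all_algebra.
From mathcomp Require Import sesquilinear complex.
From mathcomp Require Import all_classical all_reals all_analysis.
From mathcomp Require Import measurable_realfun ring lra.
From mathcomp Require finmap.

(* Two adjoint problems meet in the formula.  Differentiating the state equation
   gives the linearized states [du_j h = - D(theta)^-1 (B(u_j) h)], hence
   [F'(theta) h = Cov_J(du h, u) + Cov_J(u, du h)].  For
   [y(x, x') = sum_i y_i(x) conj(y_i(x'))] the pairing with [y] factorizes by
   Fubini into twice the real part of
   [1/J sum_(j, i) (du_j h, y_i) conj (u_j, y_i)].  By Riesz' theorem in [W],
   [D(theta)^*] is a bijection of [W] onto the antidual of [U]; if
   [D(theta)^* psi_i = y_i], then [(du_j h, y_i)] is minus the pairing of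
   [B(u_j) h] with [psi_i], and the adjoint state of [y] is almost everywhere
   [Psi(., x') = sum_i conj(y_i(x')) psi_i].  The integrand of the adjoint
   formula is therefore a finite sum of scalar L1 functions times fixed
   functionals on [X], whose Bochner integral is computed termwise. *)

Set Implicit Arguments.
Unset Strict Implicit.
Unset Printing Implicit Defensive.

Import Order.TTheory GRing.Theory Num.Theory Num.Def.
Import numFieldNormedType.Exports.
Import HBSimple.

Local Open Scope classical_set_scope.
Local Open Scope complex_scope.
Local Open Scope ring_scope.

(** * Real and imaginary parts, modulus and convergence in [R[i]] *)

Section ComplexNumbers.
Context {R : realType}.

(** The formula is claimed for every Frechet derivative and every adjoint state, while the state,
    the lift to [U], the Bochner integral and the Riesz representer are all defined by choice. Each
    construction therefore comes with a reason why its object is determined: derivatives are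
    compared along rays, adjoint states through the injectivity of the adjoint, lifts through the
    injectivity of the embedding, and Bochner integrals by evaluation at vectors of [X].

    Elements of L2 are functions and identities between them hold almost everywhere. The adjoint
    equation must hold, off one null set of $x'$, for all test vectors at once; the finite-rank form
    of [y] supplies a null set chosen before the test vector.

    Estimates only have to show that squared norms are finite or small. Cauchy-Schwarz, Hoelder and
    Minkowski are thus replaced by consequences of $2ab \le a^2 + b^2$, which explains the surplus
    factors 2 and the summands [+ 1] in the constants. *)

Lemma Re_conjC (z : R[i]) : complex.Re (conjC z) = complex.Re z.
Proof. by case: z. Qed.

Lemma Im_conjC (z : R[i]) : complex.Im (conjC z) = - complex.Im z.
Proof. by case: z. Qed.

Lemma ReD (a b : R[i]) : complex.Re (a + b) = complex.Re a + complex.Re b.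
Proof. by case: a b => ? ? []. Qed.

Lemma ImD (a b : R[i]) : complex.Im (a + b) = complex.Im a + complex.Im b.
Proof. by case: a b => ? ? []. Qed.

Lemma ReN (a : R[i]) : complex.Re (- a) = - complex.Re a.
Proof. by case: a. Qed.

Lemma ImN (a : R[i]) : complex.Im (- a) = - complex.Im a.
Proof. by case: a. Qed.

Lemma ReM (a b : R[i]) : complex.Re (a * b) =
  complex.Re a * complex.Re b - complex.Im a * complex.Im b.
Proof. by case: a b => ? ? []. Qed.

Lemma ImM (a b : R[i]) : complex.Im (a * b) =
  complex.Re a * complex.Im b + complex.Im a * complex.Re b.
Proof. by case: a b => ? ? []. Qed.

Lemma complexP (a b : R[i]) : complex.Re a = complex.Re b ->
  complex.Im a = complex.Im b -> a = b.
Proof. by case: a b => ? ? [? ?] /= -> ->. Qed.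

Lemma Re_norm_ge0 (V : normedModType R[i]) (v : V) : 0 <= complex.Re `|v|.
Proof. by rewrite -lecR norm_ReK; exact: normr_ge0. Qed.

Lemma Re_normcK (z : R[i]) : (complex.Re `|z|)%:C = `|z|.
Proof. by rewrite RRe_real ?normr_real. Qed.

Lemma Re_normc_ge0 (z : R[i]) : 0 <= complex.Re `|z|.
Proof. by rewrite normc_def sqrtr_ge0. Qed.

Lemma Re_norm_sqr (z : R[i]) :
  complex.Re `|z| ^+ 2 = complex.Re z ^+ 2 + complex.Im z ^+ 2.
Proof. by rewrite normc_def /= sqr_sqrtr ?addr_ge0 ?sqr_ge0. Qed.

Lemma ler_Re_norm (z : R[i]) : `|complex.Re z| <= complex.Re `|z|.
Proof.
rewrite -ler_sqr ?nnegrE ?Re_normc_ge0//.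
by rewrite Re_norm_sqr real_normK ?num_real// lerDl sqr_ge0.
Qed.

Lemma normc_le_ReIm (z : R[i]) (a b : R) : `|complex.Re z| <= a ->
  `|complex.Im z| <= b -> `|z| <= (a + b)%:C.
Proof.
move=> za zb; rewrite [in leLHS](complexE z) (le_trans (ler_normD _ _))//.
have normC (x : R) : `|x%:C| = `|x|%:C.
  by rewrite normc_def /= expr0n addr0 sqrtr_sqr.
have normI : `|'i%C| = 1 :> R[i].
  by rewrite normc_def /= expr0n expr1n add0r sqrtr1.
by rewrite normrM normI mul1r !normC real_complexD lerD// lecR.
Qed.

(** The $\ell^1$ norm on the plane, equivalent to the modulus. Its integral splits into those of two
    real functions, without a square root. *)
Definition l1c (z : R[i]) : R := `|complex.Re z| + `|complex.Im z|.

Lemma l1c_le z : l1c z <= 2 * complex.Re `|z|.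
Proof.
rewrite mulr_natl mulr2n lerD ?ler_Re_norm//.
rewrite -ler_sqr ?nnegrE ?Re_normc_ge0//.
by rewrite Re_norm_sqr real_normK ?num_real// lerDr sqr_ge0.
Qed.

Lemma norm_le_l1c z : complex.Re `|z| <= l1c z.
Proof. by rewrite -lecR Re_normcK; exact: normc_le_ReIm. Qed.

Lemma l1cD_le z w : l1c (z + w) <= l1c z + l1c w.
Proof. by rewrite /l1c ReD ImD addrACA lerD// ler_normD. Qed.

Lemma l1cN z : l1c (- z) = l1c z.
Proof. by rewrite /l1c ReN ImN !normrN. Qed.

Lemma dist_l1c_le z w : `|l1c z - l1c w| <= l1c (z - w).
Proof.
rewrite ler_norml; apply/andP; split.
  have := l1cD_le (w - z) z; rewrite subrK.
  by rewrite -(l1cN (w - z)) opprB; lra.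
by have := l1cD_le (z - w) w; rewrite subrK; lra.
Qed.

Lemma cvg_complex (a b : nat -> R) (l m : R) :
  a n @[n --> \oo] --> l -> b n @[n --> \oo] --> m ->
  ((a n)%:C + 'i%C * (b n)%:C : (R[i])^o) @[n --> \oo] --> (l%:C + 'i%C * m%:C : (R[i])^o).
Proof.
move=> /cvgrPdist_lt al /cvgrPdist_lt bm; apply/cvgrPdist_lt => e.
(* A positive element of [R[i]] is real, so its real part serves as the tolerance. *)
rewrite ltcE /= => /andP[/eqP e1 e0].
have e2 : 0 < complex.Re e / 2 by rewrite divr_gt0.
apply: filterS2 (al _ e2) (bm _ e2) => n an bn.
have /le_lt_trans : `|l%:C + 'i%C * m%:C - ((a n)%:C + 'i%C * (b n)%:C)| <=
    (`|l - a n| + `|m - b n|)%:C.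
  apply: normc_le_ReIm.
    by rewrite !(ReD, ReN, ReM) /= !(mul0r, mulr0, mul1r, subr0, addr0, oppr0).
  by rewrite !(ImD, ImN, ImM) /= !(mul0r, mulr0, mul1r, subr0, addr0, add0r, oppr0).
by apply; rewrite ltcE /= e1 eqxx [ltRHS]splitr ltrD.
Qed.

End ComplexNumbers.

(** * Algebra of bounded semilinear maps *)

Section Bslin.
Context {R : realType} {K : numFieldType} {s : {rmorphism K -> R[i]}}.
Context {E : normedModType K} {F : normedModType R[i]}.
Implicit Type f g : bslin s E F.

Lemma bslinN f v : f (- v) = - f v.
Proof. by rewrite -scaleN1r bslinZ rmorphN rmorph1 scaleN1r. Qed.

Lemma bslinB f u v : f (u - v) = f u - f v.
Proof. by rewrite bslinD bslinN. Qed.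

Lemma oppbslinE f v : (- f) v = - f v.
Proof. by rewrite -scaleN1r scalebslinE scaleN1r. Qed.

Lemma subbslinE f g v : (f - g) v = f v - g v.
Proof. by rewrite addbslinE oppbslinE. Qed.

Lemma bslin_sum (I : Type) (r : seq I) (u : I -> E) f :
  f (\sum_(i <- r) u i) = \sum_(i <- r) f (u i).
Proof.
elim: r => [|i r IH]; first by rewrite !big_nil bslin0.
by rewrite !big_cons bslinD IH.
Qed.

Lemma sum_bslinE (I : Type) (r : seq I) (f : I -> bslin s E F) v :
  (\sum_(i <- r) f i) v = \sum_(i <- r) f i v.
Proof.
elim: r => [|i r IH]; first by rewrite !big_nil.
by rewrite !big_cons addbslinE IH.
Qed.
End Bslin.

(** * Riesz representation *)

(* Take [t = - a / (c + 1)]; the extra 1 avoids the case [c = 0]. *)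
Lemma quadratic_form_le (R : realType) (a c e : R) : 0 <= c ->
  (forall t, 0 <= t ^+ 2 * c + 2 * t * a + e) -> a ^+ 2 <= e * (c + 1).
Proof.
move=> c0 H.
have c1 : 0 < c + 1 by rewrite ltr_wpDl.
have e0 : 0 <= e by have := H 0; rewrite expr0n /= mulr0 !mul0r !add0r.
have := H (- (a / (c + 1))).
set t := a / (c + 1); have -> : a = t * (c + 1) by rewrite mulfVK// gt_eqF.
by move=> H1; nra.
Qed.

Section MinimizingSequence.
Context {R : realType} {E : zmodType}.
(** Scaling is an arbitrary function [sc], so that one argument covers a real Hilbert space and,
    with [b] the real part of the inner product and scaling by [t%:C], a complex one. Boundedness
    and completeness are stated through squares. *)
Variables (sc : R -> E -> E) (b : E -> E -> R) (xi : E -> R) (M : R).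
Hypothesis M_ge0 : 0 <= M.
Hypothesis bC : forall v w, b v w = b w v.
Hypothesis bD : forall v w h, b (v + w) h = b v h + b w h.
Hypothesis bZ : forall t v h, b (sc t v) h = t * b v h.
Hypothesis b_ge0 : forall v, 0 <= b v v.
Hypothesis xiD : forall v w, xi (v + w) = xi v + xi w.
Hypothesis xiZ : forall t v, xi (sc t v) = t * xi v.
Hypothesis xi_le : forall v, xi v ^+ 2 <= M * b v v.
Hypothesis b_complete : forall v : nat -> E,
  (forall e : R, 0 < e -> exists N, forall m n, (N <= m)%N -> (N <= n)%N ->
    b (v m - v n) (v m - v n) < e) ->
  exists w, forall e : R, 0 < e -> exists N, forall n, (N <= n)%N ->
    b (v n - w) (v n - w) < e.

(** The energy minimized by the representer: if [w] represents [xi], then $q(v) = b(v-w,v-w) -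
    b(w,w)$. *)
Let q v := b v v - 2 * xi v.

Let bDr v w h : b h (v + w) = b h v + b h w.
Proof. by rewrite bC bD ![b _ h]bC. Qed.

Let bZr t v h : b h (sc t v) = t * b h v.
Proof. by rewrite bC bZ bC. Qed.

Let b0 h : b 0 h = 0.
Proof. by have := bD 0 0 h; rewrite addr0; lra. Qed.

Let bNl v h : b (- v) h = - b v h.
Proof. by apply/eqP; rewrite -addr_eq0 -bD addNr b0. Qed.

Let bNr v h : b h (- v) = - b h v.
Proof. by rewrite bC bNl bC. Qed.

(** Cauchy-Schwarz up to the [+ 1] of [quadratic_form_le], from the nonnegativity of $t \mapsto
    b(v+th,v+th)$. *)
Let b_CS v h : b v h ^+ 2 <= b v v * (b h h + 1).
Proof.
apply: quadratic_form_le => // t.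
by have := b_ge0 (v + sc t h); rewrite !bD !bDr !bZ !bZr [b h v]bC; lra.
Qed.

(* A minimizing sequence of [q] is Cauchy by the parallelogram law, and the
   first variation of [q] vanishes along it. *)
Lemma riesz_abstract : exists v, forall h, b v h = xi h.
Proof.
have M0 v : - M <= q v.
  rewrite /q; have := xi_le v; have := b_ge0 v; move: (b v v) (xi v) => B x B0 Bx.
  rewrite lerNl opprB lerBlDr leNgt; apply/negP => lt.
  (* If $2x > M + B$, squaring gives $4x^2 > (M+B)^2 \ge 4MB$, against [xi_le]. *)
  have p1 : 0 < 2 * x - (M + B) by lra.
  have p2 : 0 < 2 * x + (M + B) by have := M_ge0; lra.
  by have := mulr_gt0 p1 p2; have := sqr_ge0 (M - B); lra.
pose S := range q; have S_inf : has_inf S.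
  by split; [exists (q 0), 0 | exists (- M) => _ [v _ <-]].
have qm v : inf S <= q v by apply: ge_inf => //; [case: S_inf | exists v].
have [r [r_gt0 r_lim]] : exists r : nat -> R, (forall n, 0 < r n) /\
    forall e : R, 0 < e -> exists N, forall n, (N <= n)%N -> r n < e.
  exists (fun n => n.+1%:R^-1); split=> [n|e e0]; first by rewrite invr_gt0.
  have [N] := ltr_add_invr e0; rewrite add0r => Ne.
  exists N => n Nn; apply: le_lt_trans Ne.
  by rewrite lef_pV2 ?posrE// ler_nat.
have /choice[v_ hv] n : exists v, q v < inf S + r n.
  by have [_ [v _ <-] ?] := inf_adherent (r_gt0 n) S_inf; exists v.
have vC m n : b (v_ m - v_ n) (v_ m - v_ n) <= 2 * r m + 2 * r n.
  (* The linear part cancels in $q(v_m) + q(v_n) - 2q((v_m+v_n)/2) = \frac12 b(v_m-v_n,v_m-v_n)$. *)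
  have := qm (sc 2^-1 (v_ m + v_ n)); have := hv m; have := hv n; rewrite /q.
  rewrite !bZ !bZr !xiZ !bD !bDr !bNl !bNr !xiD [b (v_ n) (v_ m)]bC.
  by move: (inf S) => i; lra.
have [|w hw] := @b_complete v_.
  move=> e e0; have [|N hN] := r_lim (e / 4); first lra.
  by exists N => m n /hN mN /hN nN; apply: le_lt_trans (vC m n) _; lra.
exists w => h; apply/eqP; rewrite -subr_eq0 -sqrf_eq0 eq_le sqr_ge0 andbT.
apply/ler_addgt0Pl => e e0; rewrite addr0.
have c0 : 0 < b h h + 1 by rewrite ltr_wpDl.
(* Two squared errors are estimated below, each less than [e / 4] once multiplied by [b h h + 1];
   combining them by $(s+t)^2 \le 2s^2+2t^2$ doubles each. *)
have e'0 : 0 < e / 4 / (b h h + 1) by rewrite !divr_gt0//; lra.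
have [N hN] := r_lim _ e'0; have [N' hN'] := hw _ e'0.
pose n := maxn N N'.
(* Near-minimality: $q(v_n+th) - q(v_n) + r_n$ is nonnegative for all $t$, and its linear
   coefficient is twice [b (v_ n) h - xi h]. *)
have A1 : (b (v_ n) h - xi h) ^+ 2 <= r n * (b h h + 1).
  apply: quadratic_form_le => // t.
  have := qm (v_ n + sc t h); have := hv n; rewrite /q.
  by rewrite !bD !bDr !bZ !bZr !xiD !xiZ [b h (v_ n)]bC; lra.
have A2 := b_CS (v_ n - w) h; rewrite bD bNl in A2.
have := hN n (leq_maxl _ _); have := hN' n (leq_maxr _ _).
rewrite !ltr_pdivlMr// => B1 B2.
have : (b w h - xi h) ^+ 2 <=
    2 * (b (v_ n) h - xi h) ^+ 2 + 2 * (b (v_ n) h - b w h) ^+ 2.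
  have := sqr_ge0 ((b (v_ n) h - xi h) + (b (v_ n) h - b w h)).
  nra.
lra.
Qed.

End MinimizingSequence.

(** Restates completeness in the epsilon-N form that [riesz_abstract] takes as hypothesis. *)
Lemma cauchy_seq_cvg (K : numFieldType) (V : completeNormedModType K)
    (v : nat -> V) :
  (forall e : K, 0 < e -> exists N, forall m n, (N <= m)%N -> (N <= n)%N ->
    `|v m - v n| < e) ->
  exists w, forall e : K, 0 < e -> exists N, forall n, (N <= n)%N ->
    `|v n - w| < e.
Proof.
move=> vC.
have /cauchy_cvgP vcvg : cauchy (v @ \oo).
  apply/cauchy_ballP => e e0; have [N hN] := vC e e0.
  exists (v @` [set n | (N <= n)%N], v @` [set n | (N <= n)%N]).
    by split; exists N => // n /= Nn; exists n.
  by move=> [_ _] [/= [m Nm <-] [n Nn <-]]; rewrite -ball_normE /=; exact: hN.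
exists (lim (v @ \oo)) => e e0.
have /cvgrPdist_lt /(_ e e0)[N _ hN] : v n @[n --> \oo] --> lim (v @ \oo) by [].
by exists N => n Nn; rewrite distrC; exact: hN.
Qed.

Lemma riesz_real (R : realType) (X : completeNormedModType R)
    (ip : {dot X for idfun}) (xi : X -> R) (M : R) : hilbert_ip ip ->
  (forall a u v, xi (a *: u + v) = a * xi u + xi v) ->
  (forall v, `|xi v| <= M * `|v|) ->
  exists z, forall h, ip h z = xi h.
Proof.
move=> hip xiL xiM.
have xiD v w : xi (v + w) = xi v + xi w.
  by rewrite -[v in LHS]scale1r xiL mul1r.
have xi0 : xi 0 = 0 by have := xiD 0 0; rewrite addr0; lra.
have ipC v w : ip v w = ip w v.
  by rewrite [LHS]hermitian_subproof expr0 mul1r.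
have [z hz] : exists z, forall h, ip z h = xi h; last first.
  by exists z => h; rewrite ipC.
apply: (@riesz_abstract R X (fun a v => a *: v) ip xi (M ^+ 2)).
- exact: sqr_ge0.
- exact: ipC.
- by move=> v w h; rewrite linearDl.
- by move=> t v h; rewrite linearZl_LR.
- by move=> v; rewrite hip sqr_ge0.
- exact: xiD.
- by move=> t v; rewrite -[_ *: _]addr0 xiL xi0 addr0.
- move=> v; rewrite hip -exprMn -real_normK ?num_real// ler_pXn2r ?nnegrE//.
  exact: le_trans (xiM v).
- move=> v vC; have [|w hw] := @cauchy_seq_cvg R X v.
    move=> e e0; have [|N hN] := vC (e ^+ 2); first exact: exprn_gt0.
    exists N => m n Nm Nn; have := hN m n Nm Nn.
    by rewrite hip ltr_pXn2r ?nnegrE// ltW.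
  exists w => e e0; have [|N hN] := hw (Num.sqrt e); first by rewrite sqrtr_gt0.
  exists N => n Nn; rewrite hip -[ltRHS]sqr_sqrtr ?(ltW e0)//.
  by rewrite ltr_pXn2r ?nnegrE// ?sqrtr_ge0// hN.
Qed.

(** A complex-linear form is determined by its real part, so the real problem for
    $\mathrm{Re}(\cdot,\cdot)$ suffices. *)
Lemma riesz_complex (R : realType) (W : completeNormedModType R[i])
    (ip : {dot W for conjC}) (xi : W -> R[i]) (M : R) : hilbert_ip ip ->
  (forall a u v, xi (a *: u + v) = a * xi u + xi v) ->
  (forall v, `|xi v| <= M%:C * `|v|) ->
  exists z, forall h, ip h z = xi h.
Proof.
move=> hip xiL xiM.
have xiD v w : xi (v + w) = xi v + xi w.
  by rewrite -[v in LHS]scale1r xiL mul1r.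
have xi0 : xi 0 = 0 by apply: (addrI (xi 0)); rewrite -xiD !addr0.
have xiZ a v : xi (a *: v) = a * xi v by rewrite -[_ *: _]addr0 xiL xi0 addr0.
have ipC v w : ip v w = conjC (ip w v).
  by rewrite [LHS]hermitian_subproof expr0 mul1r.
have ipE v : complex.Re (ip v v) = complex.Re `|v| ^+ 2.
  rewrite hip -(norm_ReK v) -rmorphXn /=.
  by [].
pose b v w := complex.Re (ip v w).
have [z hz] : exists z, forall h, b z h = complex.Re (xi h); last first.
  exists z => h; apply: complexP; first by rewrite ipC Re_conjC [LHS]hz.
  (* Since $\mathrm{Re}(-ia) = \mathrm{Im}\,a$, testing at $-ih$ recovers the imaginary parts. *)
  have := hz (- 'i%C *: h).
  rewrite /b ipC Re_conjC linearZl_LR xiZ !ReM/=.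
  by rewrite !(oppr0, mul0r, mulN1r, opprK, add0r).
apply: (@riesz_abstract R W (fun a v => a%:C *: v) b _ (M ^+ 2)).
- exact: sqr_ge0.
- by move=> v w; rewrite /b ipC Re_conjC.
- by move=> v w h; rewrite /b linearDl ReD.
- by move=> t v h; rewrite /b linearZl_LR ReM /= mul0r subr0.
- by move=> v; rewrite /b ipE sqr_ge0.
- by move=> v w; rewrite xiD ReD.
- by move=> t v; rewrite xiZ ReM /= mul0r subr0.
- move=> v; rewrite /b ipE -exprMn -real_normK ?num_real//.
  have le : complex.Re `|xi v| <= M * complex.Re `|v|.
    by rewrite -lecR Re_normcK real_complexM norm_ReK.
  have le' := le_trans (ler_Re_norm (xi v)) le.
  by rewrite ler_pXn2r ?nnegrE// (le_trans _ le').
- move=> v vC; have [|w hw] := @cauchy_seq_cvg _ W v.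
    move=> e; rewrite ltcE /= => /andP[/eqP e1 e0].
    have [|N hN] := vC (complex.Re e ^+ 2); first exact: exprn_gt0.
    exists N => m n Nm Nn; have := hN m n Nm Nn.
    rewrite /b ipE ltr_pXn2r ?nnegrE ?Re_norm_ge0 ?(ltW e0)//.
    by rewrite -(norm_ReK (v m - v n)) ltcE /= e1 eqxx.
  exists w => e e0; have [|N hN] := hw (Num.sqrt e)%:C; first by rewrite ltcR sqrtr_gt0.
  exists N => n Nn; rewrite /b ipE -[ltRHS]sqr_sqrtr ?(ltW e0)//.
  by rewrite ltr_pXn2r ?nnegrE ?Re_norm_ge0 ?sqrtr_ge0// -ltcR norm_ReK hN.
Qed.

(** * Bijectivity of the adjoint of a boundedly invertible operator *)

Section AdjointBijective.
Context {R : realType} {U : normedModType R[i]} {W : completeNormedModType R[i]}.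
Variables (ip : {dot W for conjC}) (hip : hilbert_ip ip).

(** Expanding the squared norms of $v \pm w$ and $v \pm iw$ bounds the real and the imaginary part
    by $(\|v\|^2+\|w\|^2)/2$ each. Weaker than Cauchy-Schwarz, but it yields the continuity of the
    inner product. *)
Lemma hilbert_ip_le v w : `|v| <= 1 -> `|ip v w| <= (1 + complex.Re `|w| ^+ 2)%:C.
Proof.
move=> v1.
have ipC x y : ip x y = conjC (ip y x).
  by rewrite [LHS]hermitian_subproof expr0 mul1r.
have ipE x : complex.Re (ip x x) = complex.Re `|x| ^+ 2.
  by rewrite hip -(norm_ReK x) -rmorphXn.
have {}v1 : complex.Re `|v| ^+ 2 <= 1.
  by rewrite expr_le1// ?Re_norm_ge0// -lecR norm_ReK.
have ReC x y : complex.Re (ip x y) = complex.Re (ip y x).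
  by rewrite ipC Re_conjC.
have le x : complex.Re `|x| ^+ 2 = complex.Re `|w| ^+ 2 ->
    `|complex.Re (ip v x)| <= (1 + complex.Re `|w| ^+ 2) / 2.
  move=> xw.
  have H1 : 0 <= complex.Re (ip (v + x) (v + x)) by rewrite ipE sqr_ge0.
  have H2 : 0 <= complex.Re (ip (v - x) (v - x)) by rewrite ipE sqr_ge0.
  rewrite linearDl !linearDr !ReD (ReC x v) !ipE xw in H1.
  rewrite linearBl !linearBr !(ReD, ReN) (ReC x v) !ipE xw in H2.
  by rewrite ler_norml; apply/andP; split; lra.
rewrite [1 + _]splitr; apply: normc_le_ReIm; first exact: le.
have -> : complex.Im (ip v w) = complex.Re (ip v ('i%C *: w)).
  by rewrite linearZr_LR ReM /=; ring.
apply: le; rewrite normrZ.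
have -> : `|'i%C| = 1 :> R[i].
  by rewrite normc_def /= expr0n expr1n add0r sqrtr1.
by rewrite mul1r.
Qed.

Lemma inner_subproof z : bounded_semilinear (conjC \o idfun) (ip z : W -> (R[i])^o).
Proof.
have ipC x y : ip x y = conjC (ip y x).
  by rewrite [LHS]hermitian_subproof expr0 mul1r.
split=> [u v|a v|].
- by rewrite linearDr.
- by rewrite linearZr_LR.
- exists (1 + complex.Re `|z| ^+ 2) => v v1.
  by rewrite ipC norm_conjC hilbert_ip_le.
Qed.

(** The Riesz map of [W]. It is linear, not antilinear, because [cdual W] consists of antilinear
    forms. *)
Definition inner z : cdual W := mk_bslin (inner_subproof z).

(** Testing the two functionals at the preimage under [A] of [inner (w - w')] gives $(w-w',w) =
    (w-w',w')$. *)
Lemma adjoint_inj (A : CLin U (cdual W)) :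
  boundedly_invertible A -> injective (adjoint A).
Proof.
move=> [A' [_ A'K]] w w' ww'; apply/eqP; rewrite -subr_eq0 -normr_eq0.
rewrite -sqrf_eq0 -(hip (w - w')) linearBr subr_eq0; apply/eqP.
suff : inner (w - w') w = inner (w - w') w' by [].
rewrite -[inner (w - w')]A'K; apply: (inv_inj (@conjCK _)).
exact: (congr1 (fun xi : cdual U => xi (A' (inner (w - w')))) ww').
Qed.

(** Riesz' theorem is applied twice. It writes each [A v] as [inner z], so that [v = A' (inner z)];
    the equation for [w] becomes $(z,w) = \overline{\xi(A'(z,\cdot))}$, whose right side is a
    bounded linear form in $z$ and hence is represented by some [w]. *)
Lemma adjoint_onto (A : CLin U (cdual W)) : boundedly_invertible A ->
  forall xi : cdual U, exists w, adjoint A w = xi.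
Proof.
move=> [A' [AK A'K]] xi.
have innerD y z : inner (y + z) = inner y + inner z.
  by apply: bslinP0 => v; rewrite addbslinE /= linearDl.
have innerZ a z : inner (a *: z) = a *: inner z.
  by apply: bslinP0 => v; rewrite scalebslinE /= linearZl_LR.
pose g z : (R[i])^o := conjC (xi (A' (inner z))).
have gP : bounded_semilinear idfun g.
  split=> [u v|a v|].
  - by rewrite /g innerD !bslinD rmorphD.
  - rewrite /g innerZ bslinZ /= bslinZ /= rmorphM /=.
    by rewrite conjCK.
  (* The factor 2 is the bound $1 + \|w\|^2 \le 2$ that [hilbert_ip_le] gives for the norm of
     [inner v]. *)
  - exists (2 * opnorm A' * opnorm xi) => v v1; rewrite /g.
    rewrite norm_conjC (le_trans (bslin_le xi _))//= norm_conjC.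
    rewrite normr_id real_complexM ler_wpM2r ?ler0c ?opnorm_ge0//.
    rewrite (le_trans (bslin_le A' _))//= normr_id real_complexM.
    rewrite ler_wpM2r ?ler0c ?opnorm_ge0// bslin_normE lecR.
    apply: opnorm_le => w w1; rewrite (le_trans (hilbert_ip_le _ v1))// lecR.
    have : complex.Re `|w| ^+ 2 <= 1; last by lra.
    by rewrite expr_le1// ?Re_norm_ge0// -lecR norm_ReK.
have [||w hw] := @riesz_complex R W ip (mk_bslin gP) (opnorm (mk_bslin gP)) hip.
  by move=> a u v; rewrite bslinD bslinZ.
  move=> v; apply: le_trans (bslin_le (mk_bslin gP) v) _.
  by rewrite /= normr_id mulrC.
exists w; apply: bslinP0 => v; rewrite /adjoint /= /adjoint_fun.
have [z Az] : exists z, A v = inner z; last first.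
  by have := hw z; rewrite Az /= => ->; rewrite /g conjCK -Az AK.
have [||z hz] := @riesz_complex R W ip (fun h => conjC (A v h)) (opnorm (A v)) hip.
  by move=> a x y; rewrite bslinD bslinZ /= rmorphD rmorphM /= conjCK.
  by move=> h; rewrite norm_conjC mulrC (le_trans (bslin_le _ h))//= norm_conjC normr_id.
have ipC x y : ip x y = conjC (ip y x).
  by rewrite [LHS]hermitian_subproof expr0 mul1r.
by exists z; apply: bslinP0 => h; rewrite /= ipC hz conjCK.
Qed.

End AdjointBijective.

(** * Complex-valued square-integrable functions *)

Section ComplexFunctions.
Context {R : realType} {disp : measure_display} {T : measurableType disp}.
Variables (mu : {measure set T -> \bar R}) (D : set T) (mD : measurable D).
Implicit Types f g : T -> R[i].

Definition cmeasurable f :=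
  measurable_fun D (fun x => complex.Re (f x)) /\
  measurable_fun D (fun x => complex.Im (f x)).

Lemma cmeasurable_cst c : cmeasurable (fun=> c).
Proof. by split; exact: measurable_cst. Qed.

Lemma cmeasurableD f g : cmeasurable f -> cmeasurable g ->
  cmeasurable (fun x => f x + g x).
Proof.
move=> [f1 f2] [g1 g2]; split.
  by under eq_fun do rewrite ReD; exact: measurable_funD.
by under eq_fun do rewrite ImD; exact: measurable_funD.
Qed.

Lemma cmeasurableM f g : cmeasurable f -> cmeasurable g ->
  cmeasurable (fun x => f x * g x).
Proof.
move=> [f1 f2] [g1 g2]; split.
  by under eq_fun do rewrite ReM; apply: measurable_funB; exact: measurable_funM.
by under eq_fun do rewrite ImM; apply: measurable_funD; exact: measurable_funM.
Qed.

Lemma cmeasurableZ c f : cmeasurable f -> cmeasurable (fun x => c * f x).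
Proof. by apply: cmeasurableM; exact: cmeasurable_cst. Qed.

Lemma cmeasurable_conj f : cmeasurable f -> cmeasurable (fun x => conjC (f x)).
Proof.
move=> [f1 f2]; split; first by under eq_fun do rewrite Re_conjC.
by under eq_fun do rewrite Im_conjC; exact: measurableT_comp.
Qed.

Lemma cmeasurableB f g : cmeasurable f -> cmeasurable g ->
  cmeasurable (fun x => f x - g x).
Proof.
move=> mf mg; under eq_fun do rewrite -mulN1r.
by apply: cmeasurableD => //; apply: cmeasurableM => //; exact: cmeasurable_cst.
Qed.

Lemma cmeasurable_sum (I : Type) (r : seq I) (h : I -> T -> R[i]) :
  (forall i, cmeasurable (h i)) -> cmeasurable (fun x => \sum_(i <- r) h i x).
Proof.
move=> mh; elim: r => [|i r IH].
  by under eq_fun do rewrite big_nil; exact: cmeasurable_cst.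
by under eq_fun do rewrite big_cons; exact: cmeasurableD.
Qed.

(** The squared modulus as a polynomial in the two parts, accessible to [ring] and [lra]. *)
Definition sqnorm (z : R[i]) : R := complex.Re z ^+ 2 + complex.Im z ^+ 2.

Lemma sqnorm_ge0 z : 0 <= sqnorm z.
Proof. by rewrite addr_ge0// sqr_ge0. Qed.

Lemma sqnormM z w : sqnorm (z * w) = sqnorm z * sqnorm w.
Proof. by rewrite /sqnorm ReM ImM; ring. Qed.

Lemma sqnorm_conj z : sqnorm (conjC z) = sqnorm z.
Proof. by rewrite /sqnorm Re_conjC Im_conjC sqrrN. Qed.

(** The parallelogram identity with the term [sqnorm (z - w)] dropped. *)
Lemma sqnormD_le z w : sqnorm (z + w) <= 2 * sqnorm z + 2 * sqnorm w.
Proof.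
have := sqnorm_ge0 (z - w).
by rewrite /sqnorm !ReD !ImD !ReN !ImN; lra.
Qed.

Lemma sqnorm_eq0 z : sqnorm z = 0 -> z = 0.
Proof.
move=> /eqP; rewrite /sqnorm paddr_eq0 ?sqr_ge0// !sqrf_eq0.
by case: z => a b /andP[/eqP/= -> /eqP/= ->].
Qed.

Lemma measurable_sqnorm f : cmeasurable f ->
  measurable_fun D (fun x => (sqnorm (f x))%:E).
Proof.
move=> [f1 f2]; apply/measurable_EFinP.
by apply: measurable_funD; exact: measurable_funX.
Qed.

Definition sqint f : \bar R := (\int[mu]_(x in D) (sqnorm (f x))%:E)%E.

Lemma sqint_ge0 f : (0 <= sqint f)%E.
Proof. by apply: integral_ge0 => x _; rewrite lee_fin sqnorm_ge0. Qed.

Lemma L2norm_sqint f : L2norm mu D f = (sqint f `^ 2^-1)%E.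
Proof.
rewrite /L2norm unlock /sqint [in RHS]integral_mkcond; congr (_ `^ _)%E.
apply: eq_integral => x _; rewrite /patch; case: ifPn => _ /=.
  by rewrite ger0_norm ?Re_normc_ge0// powR_mulrn ?Re_normc_ge0// Re_norm_sqr.
by rewrite normr0 powR0.
Qed.

Lemma L2norm_le f (c : R) : 0 <= c ->
  (L2norm mu D f <= c%:E)%E <-> (sqint f <= (c ^+ 2)%:E)%E.
Proof.
move=> c0; rewrite L2norm_sqint; have := sqint_ge0 f.
case: (sqint f) => [q| |] //=; last by rewrite invr_eq0 pnatr_eq0.
rewrite lee_fin => q0; rewrite !lee_fin.
by rewrite powR12_sqrt// -{2}(sqr_sqrtr q0) ler_pXn2r ?nnegrE ?sqrtr_ge0.
Qed.

Lemma L2P f : L2 mu D f <-> cmeasurable f /\ (sqint f < +oo)%E.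
Proof.
have lt : ((L2norm mu D f < +oo) = (sqint f < +oo))%E.
  rewrite L2norm_sqint; have := sqint_ge0 f; case: (sqint f) => [q| |] //=.
    by rewrite !ltry.
  by rewrite /= invr_eq0 pnatr_eq0.
by split=> [[f1 f2]|[[f1 f2]]]; rewrite ?lt => f3; split=> //; rewrite ?lt.
Qed.

Lemma sqint_ae f g : cmeasurable f -> cmeasurable g ->
  {ae mu, forall x, D x -> f x = g x} -> sqint f = sqint g.
Proof.
move=> mf mg fg; apply: ae_eq_integral => //; try exact: measurable_sqnorm.
by apply: filterS fg => x /= fg Dx; rewrite fg.
Qed.

Lemma sqint0_ae f : cmeasurable f -> sqint f = 0%E ->
  {ae mu, forall x, D x -> f x = 0}.
Proof.
move=> mf f0.
have : (\int[mu]_(x in D) `|(sqnorm (f x))%:E| = 0)%E.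
  by rewrite -[RHS]f0; apply: eq_integral => x _; rewrite /= ger0_norm// sqnorm_ge0.
move/(ae_eq_integral_abs mu mD (measurable_sqnorm mf)).
by apply: filterS => x /= h Dx; apply: sqnorm_eq0; have [] := h Dx.
Qed.

Lemma sqintM_cst c f : cmeasurable f ->
  sqint (fun x => c * f x) = ((sqnorm c)%:E * sqint f)%E.
Proof.
move=> mf; rewrite /sqint -ge0_integralZl ?lee_fin ?sqnorm_ge0//.
- by apply: eq_integral => x _; rewrite sqnormM.
- exact: measurable_sqnorm.
- by move=> x _; rewrite lee_fin sqnorm_ge0.
Qed.

Lemma sqintD_le f g : cmeasurable f -> cmeasurable g ->
  (sqint (fun x => f x + g x)%R <= 2%:E * sqint f + 2%:E * sqint g)%E.
Proof.
move=> mf mg.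
have p h x : D x -> (0 <= (sqnorm (h x))%:E)%E by rewrite lee_fin sqnorm_ge0.
rewrite /sqint -!ge0_integralZl//; do ?[exact: measurable_sqnorm|exact: p].
rewrite -ge0_integralD//; last 4 first.
- by move=> x Dx; rewrite mule_ge0// p.
- by apply: measurable_funeM; exact: measurable_sqnorm.
- by move=> x Dx; rewrite mule_ge0// p.
- by apply: measurable_funeM; exact: measurable_sqnorm.
apply: ge0_le_integral => //.
- by move=> x _; rewrite lee_fin sqnorm_ge0.
- exact/measurable_sqnorm/cmeasurableD.
- by apply: emeasurable_funD; apply: measurable_funeM; exact: measurable_sqnorm.
- by move=> x _; rewrite -!EFinM -EFinD lee_fin sqnormD_le.
Qed.

Lemma L2D f g : L2 mu D f -> L2 mu D g -> L2 mu D (fun x => f x + g x).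
Proof.
move=> /L2P[mf f2] /L2P[mg g2]; apply/L2P; split; first exact: cmeasurableD.
apply: le_lt_trans (sqintD_le mf mg) _.
by rewrite lte_add_pinfty// lte_mul_pinfty.
Qed.

Lemma L2Z c f : L2 mu D f -> L2 mu D (fun x => c * f x).
Proof.
move=> /L2P[mf f2]; apply/L2P; split.
  by apply: cmeasurableM => //; exact: cmeasurable_cst.
by rewrite sqintM_cst// lte_mul_pinfty// lee_fin sqnorm_ge0.
Qed.

Lemma L2_conj f : L2 mu D f -> L2 mu D (fun x => conjC (f x)).
Proof.
move=> /L2P[mf f2]; apply/L2P; split; first exact: cmeasurable_conj.
by rewrite /sqint; under eq_integral do rewrite sqnorm_conj.
Qed.

Lemma L2_0 : L2 mu D (fun=> 0).
Proof.
apply/L2P; split; first exact: cmeasurable_cst.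
by rewrite /sqint /sqnorm /= expr0n/= addr0 integral0.
Qed.

Lemma L2_sum (I : Type) (r : seq I) (h : I -> T -> R[i]) :
  (forall i, L2 mu D (h i)) -> L2 mu D (fun x => \sum_(i <- r) h i x).
Proof.
move=> h2; elim: r => [|i r IH].
  by under eq_fun do rewrite big_nil; exact: L2_0.
by under eq_fun do rewrite big_cons; exact: L2D.
Qed.

Definition cintegrable f :=
  mu.-integrable D (EFin \o (fun x => complex.Re (f x))) /\
  mu.-integrable D (EFin \o (fun x => complex.Im (f x))).

Lemma cintegrableP f : cmeasurable f ->
  (\int[mu]_(x in D) (`|complex.Re (f x)| + `|complex.Im (f x)|)%:E < +oo)%E ->
  cintegrable f.
Proof.
move=> [f1 f2] lt; split; apply/integrableP; split; try exact/measurable_EFinP.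
  apply: le_lt_trans lt; apply: ge0_le_integral => //=.
  - exact/measurable_EFinP/measurableT_comp.
  - by apply/measurable_EFinP/measurable_funD; exact: measurableT_comp.
  - by move=> x _; rewrite lee_fin lerDl.
apply: le_lt_trans lt; apply: ge0_le_integral => //=.
- exact/measurable_EFinP/measurableT_comp.
- by apply/measurable_EFinP/measurable_funD; exact: measurableT_comp.
- by move=> x _; rewrite lee_fin lerDr.
Qed.

(** A substitute for Hoelder's inequality: each of the two parts of the product is pointwise at most
    half of [sqnorm (f x) + sqnorm (g x)]. *)
Lemma l1_mul_le f g : cmeasurable f -> cmeasurable g ->
  (\int[mu]_(x in D) (`|complex.Re (f x * g x)| + `|complex.Im (f x * g x)|)%:E
   <= sqint f + sqint g)%E.
Proof.
move=> mf mg.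
have p h x : D x -> (0 <= (sqnorm (h x))%:E)%E by rewrite lee_fin sqnorm_ge0.
rewrite -ge0_integralD//; do ?[exact: p|exact: measurable_sqnorm].
have [m1 m2] := cmeasurableM mf mg.
apply: ge0_le_integral => //.
- by apply/measurable_EFinP/measurable_funD; exact: measurableT_comp.
- by apply: emeasurable_funD; exact: measurable_sqnorm.
- move=> x _; rewrite -EFinD lee_fin /sqnorm ReM ImM.
  move: (complex.Re (f x)) (complex.Im (f x)) (complex.Re (g x)) (complex.Im (g x)) => a b c e.
  rewrite [leRHS]splitr lerD// ler_norml; apply/andP; split.
  - by have := sqr_ge0 (a + c); have := sqr_ge0 (b - e); lra.
  - by have := sqr_ge0 (a - c); have := sqr_ge0 (b + e); lra.
  - by have := sqr_ge0 (a + e); have := sqr_ge0 (b + c); lra.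
  - by have := sqr_ge0 (a - e); have := sqr_ge0 (b - c); lra.
Qed.

Lemma L2_cintegrableM f g : L2 mu D f -> L2 mu D g ->
  cintegrable (fun x => f x * g x).
Proof.
move=> /L2P[mf f2] /L2P[mg g2]; apply: cintegrableP; first exact: cmeasurableM.
by apply: le_lt_trans (l1_mul_le mf mg) _; rewrite lte_add_pinfty.
Qed.

Lemma cintegrable_meas f : cintegrable f -> cmeasurable f.
Proof.
by move=> [/integrableP[/measurable_EFinP f1 _] /integrableP[/measurable_EFinP f2 _]].
Qed.

Lemma cintegrableD f g : cintegrable f -> cintegrable g ->
  cintegrable (fun x => f x + g x).
Proof.
move=> [f1 f2] [g1 g2]; split; rewrite /comp.
  by under eq_fun do rewrite ReD EFinD; exact: integrableD.
by under eq_fun do rewrite ImD EFinD; exact: integrableD.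
Qed.

Lemma cintegrableZ c f : cintegrable f -> cintegrable (fun x => c * f x).
Proof.
move=> [f1 f2]; split; rewrite /comp.
  under eq_fun do rewrite ReM EFinB !EFinM.
  by apply: integrableB => //; exact: integrableZl.
under eq_fun do rewrite ImM EFinD !EFinM.
by apply: integrableD => //; exact: integrableZl.
Qed.

Lemma cintegrable0 : cintegrable (fun=> 0).
Proof. by split; exact: integrable0. Qed.

Lemma cintegrable_sum (I : Type) (r : seq I) (h : I -> T -> R[i]) :
  (forall i, cintegrable (h i)) -> cintegrable (fun x => \sum_(i <- r) h i x).
Proof.
move=> ih; elim: r => [|i r IH].
  by under eq_fun do rewrite big_nil; exact: cintegrable0.
by under eq_fun do rewrite big_cons; exact: cintegrableD.
Qed.

Lemma cintegralD f g : cintegrable f -> cintegrable g ->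
  cintegral mu D (fun x => f x + g x) = cintegral mu D f + cintegral mu D g.
Proof.
move=> [f1 f2] [g1 g2]; rewrite /cintegral; apply: complexP => /=.
  rewrite -RintegralD//; apply: eq_Rintegral => x _; exact: ReD.
rewrite -RintegralD//; apply: eq_Rintegral => x _; exact: ImD.
Qed.

Lemma cintegralZ c f : cintegrable f ->
  cintegral mu D (fun x => c * f x) = c * cintegral mu D f.
Proof.
move=> [f1 f2]; rewrite /cintegral; apply: complexP => /=.
  rewrite ReM /= -!RintegralZl// -RintegralB//; do ?exact: (integrableZl mD _ f1);
    do ?exact: (integrableZl mD _ f2).
  by apply: eq_Rintegral => x _; rewrite ReM.
rewrite ImM /= -!RintegralZl// -RintegralD//; do ?exact: (integrableZl mD _ f1);
  do ?exact: (integrableZl mD _ f2).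
by apply: eq_Rintegral => x _; rewrite ImM.
Qed.

Lemma cintegral0 : cintegral mu D (fun=> 0) = 0.
Proof.
by rewrite /cintegral /Rintegral !integral0.
Qed.

Lemma cintegral_sum (I : Type) (r : seq I) (h : I -> T -> R[i]) :
  (forall i, cintegrable (h i)) ->
  cintegral mu D (fun x => \sum_(i <- r) h i x) = \sum_(i <- r) cintegral mu D (h i).
Proof.
move=> ih; elim: r => [|i r IH].
  by under eq_fun do rewrite big_nil; rewrite big_nil cintegral0.
under eq_fun do rewrite big_cons; rewrite big_cons cintegralD ?IH//.
exact: cintegrable_sum.
Qed.

Lemma cintegral_conj f : cintegrable f ->
  cintegral mu D (fun x => conjC (f x)) = conjC (cintegral mu D f).
Proof.
move=> [f1 f2]; apply: complexP; rewrite ?Re_conjC ?Im_conjC /=.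
  by apply: eq_Rintegral => x _; rewrite Re_conjC.
rewrite -mulN1r -RintegralZl//; apply: eq_Rintegral => x _.
by rewrite Im_conjC mulN1r.
Qed.

Lemma eq_cintegral f g : (forall x, D x -> f x = g x) ->
  cintegral mu D f = cintegral mu D g.
Proof.
by move=> fg; congr (_ +i* _); apply: eq_Rintegral => x /set_mem/fg ->.
Qed.

Lemma ae_eq_cintegral f g : cmeasurable f -> cmeasurable g ->
  {ae mu, forall x, D x -> f x = g x} -> cintegral mu D f = cintegral mu D g.
Proof.
move=> [f1 f2] [g1 g2] fg; congr (_ +i* _); congr fine;
  apply: ae_eq_integral => //; try exact/measurable_EFinP;
  by apply: filterS fg => x /= h Dx; rewrite h.
Qed.

Lemma L2_cmeasurable f : L2 mu D f -> cmeasurable f.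
Proof. by move=> /L2P[]. Qed.

End ComplexFunctions.

(** * Products of functions of two separate variables, and null sets in the product space *)

Section Tensor.
Context {R : realType} {disp : measure_display} {T : measurableType disp}.
Variables (mu : {sigma_finite_measure set T -> \bar R}) (D : set T).
Hypothesis mD : measurable D.
Local Notation mu2 := (mu \x mu)%E.
Local Notation D2 := (D `*` D).

(** The restriction to the square factors, so the theorems of Fubini and Tonelli on the full product
    give their versions on [D2]. *)
Lemma restrict_tensor (a b : T -> R) :
  (fun z : T * T => a z.1 * b z.2) \_ D2 = fun z => (a \_ D) z.1 * (b \_ D) z.2.
Proof.
apply/funext => -[x y]; rewrite /patch /= in_setX.
by case: (x \in D); case: (y \in D); rewrite /= ?(mulr0, mul0r).
Qed.

Lemma measurable_tensor (a b : T -> R) : measurable_fun setT a ->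
  measurable_fun setT b -> measurable_fun setT (fun z : T * T => a z.1 * b z.2).
Proof.
by move=> ma mb; apply: measurable_funM; apply: measurableT_comp.
Qed.

Lemma ge0_integral_tensorT (a b : T -> R) : measurable_fun setT a ->
  measurable_fun setT b -> (forall x, 0 <= a x) -> (forall x, 0 <= b x) ->
  (\int[mu2]_z (a z.1 * b z.2)%:E = \int[mu]_x (a x)%:E * \int[mu]_x (b x)%:E)%E.
Proof.
move=> ma mb a0 b0.
rewrite (@fubini_tonelli1 _ _ _ _ _ mu mu (fun z : T * T => (a z.1 * b z.2)%:E)) /=; first last.
- by move=> z; rewrite lee_fin mulr_ge0.
- by apply/measurable_EFinP; exact: measurable_tensor.
rewrite /fubini_F /= -ge0_integralZr//; first last.
- by apply: integral_ge0 => x _; rewrite lee_fin.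
- by move=> x _; rewrite lee_fin.
- exact/measurable_EFinP.
apply: eq_integral => x _; under eq_integral do rewrite EFinM.
rewrite ge0_integralZl ?lee_fin//; first exact/measurable_EFinP.
by move=> y _; rewrite lee_fin.
Qed.

Lemma integrable_tensorT (a b : T -> R) : mu.-integrable setT (EFin \o a) ->
  mu.-integrable setT (EFin \o b) ->
  mu2.-integrable setT (fun z => (a z.1 * b z.2)%:E).
Proof.
move=> /integrableP[/measurable_EFinP ma ai] /integrableP[/measurable_EFinP mb bi].
apply/integrableP; split; first by apply/measurable_EFinP; exact: measurable_tensor.
under eq_integral do rewrite abse_EFin normrM.
rewrite (@ge0_integral_tensorT (fun x => `|a x|) (fun x => `|b x|))//; try exact: measurableT_comp.
rewrite lte_mul_pinfty//; first by apply: integral_ge0 => x _; rewrite lee_fin.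
rewrite ge0_fin_numE//.
by apply: integral_ge0 => x _; rewrite lee_fin.
Qed.

Lemma Rintegral_tensorT (a b : T -> R) : mu.-integrable setT (EFin \o a) ->
  mu.-integrable setT (EFin \o b) ->
  \int[mu2]_z (a z.1 * b z.2) = \int[mu]_x a x * \int[mu]_x b x.
Proof.
move=> ia ib; rewrite [LHS]/Rintegral -integral12_prod_meas1; last exact: integrable_tensorT.
rewrite /fubini_F /=.
under eq_integral => x _.
  under eq_integral do rewrite EFinM.
  rewrite integralZl// -[X in (_ * X)%E](fineK (integrable_fin_num _ ib))//.
  over.
by rewrite integralZr// fineM// ?integrable_fin_num.
Qed.

Lemma ge0_integral_tensor (a b : T -> R) : measurable_fun D a ->
  measurable_fun D b -> (forall x, 0 <= a x) -> (forall x, 0 <= b x) ->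
  (\int[mu2]_(z in D2) (a z.1 * b z.2)%:E =
   \int[mu]_(x in D) (a x)%:E * \int[mu]_(x in D) (b x)%:E)%E.
Proof.
move=> ma mb a0 b0; rewrite integral_mkcond [in RHS]integral_mkcond.
rewrite [X in (_ * X)%E]integral_mkcond.
have p (c : T -> R) : (forall x, 0 <= c x) -> forall x, 0 <= (c \_ D) x.
  by move=> c0 x; rewrite /patch; case: ifP.
rewrite !(restrict_EFin, restrict_tensor).
by apply: ge0_integral_tensorT; do ?exact: p; exact/(measurable_restrictT _ mD).
Qed.

Lemma integrable_tensor (a b : T -> R) : mu.-integrable D (EFin \o a) ->
  mu.-integrable D (EFin \o b) ->
  mu2.-integrable D2 (fun z => (a z.1 * b z.2)%:E).
Proof.
move=> /(integrable_mkcond _ mD) ia /(integrable_mkcond _ mD) ib.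
apply/(integrable_mkcond _ (measurableX mD mD)).
rewrite !(restrict_EFin, restrict_tensor) in ia ib *.
exact: integrable_tensorT.
Qed.

Lemma Rintegral_tensor (a b : T -> R) : mu.-integrable D (EFin \o a) ->
  mu.-integrable D (EFin \o b) ->
  \int[mu2]_(z in D2) (a z.1 * b z.2) = \int[mu]_(x in D) a x * \int[mu]_(x in D) b x.
Proof.
move=> /(integrable_mkcond _ mD) ia /(integrable_mkcond _ mD) ib.
rewrite Rintegral_mkcond [in RHS]Rintegral_mkcond [X in _ * X]Rintegral_mkcond.
rewrite !(restrict_EFin, restrict_tensor) in ia ib *.
exact: Rintegral_tensorT.
Qed.

Lemma cmeasurable_fst (f : T -> R[i]) : cmeasurable D f ->
  cmeasurable D2 (fun z => f z.1).
Proof.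
move=> [f1 f2]; split.
  apply: (measurable_comp mD _ f1) => [_ [z [Dz _] <-]//|].
  exact: measurable_funS measurable_fst.
apply: (measurable_comp mD _ f2) => [_ [z [Dz _] <-]//|].
exact: measurable_funS measurable_fst.
Qed.

Lemma cmeasurable_snd (f : T -> R[i]) : cmeasurable D f ->
  cmeasurable D2 (fun z => f z.2).
Proof.
move=> [f1 f2]; split.
  apply: (measurable_comp mD _ f1) => [_ [z [_ Dz] <-]//|].
  exact: measurable_funS measurable_snd.
apply: (measurable_comp mD _ f2) => [_ [z [_ Dz] <-]//|].
exact: measurable_funS measurable_snd.
Qed.

Lemma sqint_tensor (f g : T -> R[i]) : cmeasurable D f -> cmeasurable D g ->
  sqint mu2 D2 (fun z => f z.1 * g z.2) = (sqint mu D f * sqint mu D g)%E.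
Proof.
move=> [f1 f2] [g1 g2]; rewrite /sqint.
under eq_integral do rewrite sqnormM.
rewrite (@ge0_integral_tensor (fun x => sqnorm (f x)) (fun x => sqnorm (g x)))//;
  do ?[by move=> x; exact: sqnorm_ge0].
  by apply: measurable_funD; exact: measurable_funX.
by apply: measurable_funD; exact: measurable_funX.
Qed.

Lemma L2_tensor (f g : T -> R[i]) : L2 mu D f -> L2 mu D g ->
  L2 mu2 D2 (fun z => f z.1 * g z.2).
Proof.
move=> /L2P[mf f2] /L2P[mg g2]; apply/L2P; split.
  by apply: cmeasurableM; [exact: cmeasurable_fst|exact: cmeasurable_snd].
rewrite sqint_tensor// lte_mul_pinfty// ?sqint_ge0// ge0_fin_numE ?sqint_ge0//.
Qed.

Lemma cintegrable_tensor (f g : T -> R[i]) : cintegrable mu D f ->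
  cintegrable mu D g -> cintegrable mu2 D2 (fun z => f z.1 * g z.2).
Proof.
move=> [f1 f2] [g1 g2]; have mD2 := measurableX mD mD; split; rewrite /comp.
  under eq_fun do rewrite ReM EFinB.
  exact: (integrableB mD2 (integrable_tensor f1 g1) (integrable_tensor f2 g2)).
under eq_fun do rewrite ImM EFinD.
exact: (integrableD mD2 (integrable_tensor f1 g2) (integrable_tensor f2 g1)).
Qed.

Lemma cintegral_tensor (f g : T -> R[i]) : cintegrable mu D f ->
  cintegrable mu D g ->
  cintegral mu2 D2 (fun z => f z.1 * g z.2) = cintegral mu D f * cintegral mu D g.
Proof.
move=> [f1 f2] [g1 g2]; have mD2 := measurableX mD mD.
apply: complexP; rewrite ?ReM ?ImM /=.
  rewrite -(Rintegral_tensor f1 g1) -(Rintegral_tensor f2 g2).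
  rewrite -(RintegralB mD2 (integrable_tensor f1 g1) (integrable_tensor f2 g2)).
  by apply: eq_Rintegral => x _; rewrite ReM.
rewrite -(Rintegral_tensor f1 g2) -(Rintegral_tensor f2 g1).
rewrite -(RintegralD mD2 (integrable_tensor f1 g2) (integrable_tensor f2 g1)).
by apply: eq_Rintegral => x _; rewrite ImM.
Qed.

Lemma ae_fst (P : T -> Prop) : {ae mu, forall x, D x -> P x} ->
  {ae mu2, forall z, D2 z -> P z.1}.
Proof.
move=> [N [mN N0 NP]]; exists (N `*` setT); split.
- exact: measurableX.
(* The total mass may be infinite; the product with 0 is 0 all the same. *)
- transitivity (mu N * mu setT)%E; first exact: product_measure1E.
  by rewrite N0 mul0e.
- by move=> z /= nP; split=> //; apply: NP => /= h; apply: nP => -[? ?]; exact: h.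
Qed.

Lemma ae_snd (P : T -> Prop) : {ae mu, forall x, D x -> P x} ->
  {ae mu2, forall z, D2 z -> P z.2}.
Proof.
move=> [N [mN N0 NP]]; exists (setT `*` N); split.
- exact: measurableX.
- transitivity (mu setT * mu N)%E; first exact: product_measure1E.
  by rewrite N0 mule0.
- by move=> z /= nP; split=> //; apply: NP => /= h; apply: nP => -[? ?]; exact: h.
Qed.

(** By Tonelli the measures of the sections of a null set integrate to 0, hence vanish for almost
    every [y]. This carries the finite-rank form of [y] in the covariance cone over to its
    sections. *)
Lemma ae_section (P : T * T -> Prop) : {ae mu2, forall z, D2 z -> P z} ->
  {ae mu, forall y, D y -> {ae mu, forall x, D x -> P (x, y)}}.
Proof.
move=> [N [mN N0 NP]].
have mG : measurable_fun setT (fun y => mu (ysection N y)).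
  exact: measurable_fun_ysection.
have : (\int[mu]_y `|mu (ysection N y)| = 0)%E.
  under eq_integral do rewrite gee0_abs//.
  have <- : (\int[mu2]_z (\1_N z : R)%:E = 0)%E by rewrite integral_indic// setIT.
  rewrite (indic_fubini_tonelli1 mu mu mN) (indic_fubini_tonelli mu mu mN).
  by rewrite (indic_fubini_tonelli_GE mu mN).
move/(ae_eq_integral_abs mu measurableT mG).
apply: filterS => y /= /(_ Logic.I) y0 Dy.
exists (ysection N y); split => //; first exact: measurable_ysection.
move=> x /= nP; rewrite /ysection /= inE; apply: NP => /= h; apply: nP => Dx.
exact: h.
Qed.

End Tensor.

(** * Bochner integrals *)

Section SimpleFunctions.
Context {R : realType} {disp : measure_display} {T : measurableType disp}.
Variables (mu : {measure set T -> \bar R}) (D : set T) (mD : measurable D).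

(** Preimages are finite unions of level sets, so [phi] may be any function whatever. *)
Lemma bsimple_measurable (V : normedModType R[i]) (s : T -> V) (phi : V -> R) :
  bsimple mu D s -> measurable_fun D (fun x => phi (s x)).
Proof.
move=> [fs ms] _ Y mY.
rewrite [X in measurable X](_ : _ = \bigcup_(v in s @` D)
    (if `[< Y (phi v) >] then D `&` s @^-1` [set v] else set0)).
  by apply: fin_bigcup_measurable => // v _; case: ifP => // _; have [] := ms v.
apply/seteqP; split=> [x [Dx /= Yx]|x [v _]].
  by exists (s x); [exists x|case: asboolP].
by case: asboolP => // Yv [Dx /= sx]; split=> //=; rewrite sx.
Qed.

Lemma bsimple_cmeasurable (V : normedModType R[i]) (s : T -> V) (phi : V -> R[i]) :
  bsimple mu D s -> cmeasurable D (fun x => phi (s x)).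
Proof.
move=> ss; split.
  exact: (bsimple_measurable (fun v => complex.Re (phi v)) ss).
exact: (bsimple_measurable (fun v => complex.Im (phi v)) ss).
Qed.

(** Since [op 0 0 = 0], a nonzero value of the result forces one of the two arguments to be nonzero,
    and this confines the level set to one of finite measure. *)
Lemma bsimple_op (V1 V2 V3 : normedModType R[i]) (op : V1 -> V2 -> V3)
    (s1 : T -> V1) (s2 : T -> V2) : op 0 0 = 0 ->
  bsimple mu D s1 -> bsimple mu D s2 -> bsimple mu D (fun x => op (s1 x) (s2 x)).
Proof.
move=> op0 [f1 m1] [f2 m2].
pose F := (s1 @` D) `*` (s2 @` D); have fF : finite_set F by exact: finite_setX.
pose L v (p : V1 * V2) := if op p.1 p.2 == v then
  (D `&` s1 @^-1` [set p.1]) `&` (D `&` s2 @^-1` [set p.2]) else set0.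
have mL v p : measurable (L v p).
  by rewrite /L; case: ifP => // _; apply: measurableI; [case: (m1 p.1)|case: (m2 p.2)].
have LE v : D `&` (fun x => op (s1 x) (s2 x)) @^-1` [set v] = \bigcup_(p in F) L v p.
  apply/seteqP; split=> [x [Dx /= xv]|x [p _]].
    by exists (s1 x, s2 x); [split; exists x|rewrite /L /= xv eqxx].
  by rewrite /L; case: eqP => // pv [[Dx /= ->] [_ /= ->]].
split.
  apply: (@sub_finite_set _ _ ((fun p => op p.1 p.2) @` F)).
    by move=> _ [x Dx <-]; exists (s1 x, s2 x) => //; split; exists x.
  exact: finite_image.
move=> v; rewrite LE; split; first exact: fin_bigcup_measurable.
move=> v0; apply: le_lt_trans (content_sub_fsum mu fF _ _ (@subset_refl _ _)) _ => //.
  exact: fin_bigcup_measurable.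
rewrite fsbig_finite//=; apply: lte_sum_pinfty => p _.
rewrite /L; case: eqP => [pv|]; last by rewrite measure0.
have [p10|p10] := eqVneq p.1 0; last first.
  have [mp fp] := m1 p.1; apply: le_lt_trans (fp p10).
  by apply: le_measure; rewrite ?inE//; apply: measurableI => //; case: (m2 p.2).
have [p20|p20] := eqVneq p.2 0; last first.
  have [mp fp] := m2 p.2; apply: le_lt_trans (fp p20).
  by apply: le_measure; rewrite ?inE//; apply: measurableI => //; case: (m1 p.1).
by move: v0; rewrite -pv p10 p20 op0 eqxx.
Qed.

Lemma bsimple_comp (V1 V2 : normedModType R[i]) (f : V1 -> V2) (s : T -> V1) :
  f 0 = 0 -> bsimple mu D s -> bsimple mu D (fun x => f (s x)).
Proof. by move=> f0 ss; apply: (@bsimple_op _ _ _ (fun v _ => f v) s s). Qed.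

Lemma bsimple0 (V : normedModType R[i]) : bsimple mu D (fun=> 0 : V).
Proof.
split; first by apply: (@sub_finite_set _ _ [set 0]) => [_ [x _ <-]|]//.
move=> v; have [->|v0] := eqVneq v 0.
  by rewrite (_ : _ @^-1` _ = setT) ?setIT//; apply/seteqP; split.
rewrite (_ : _ @^-1` _ = set0) ?setI0 ?measure0; first by split.
by apply/seteqP; split => // x /= v00; move: v0; rewrite -v00 eqxx.
Qed.

Lemma bsimple_real (f : T -> R) : finite_set (f @` D) -> measurable_fun D f ->
  (forall r : R, r != 0 -> (mu (D `&` f @^-1` [set r]) < +oo)%E) ->
  bsimple mu D (fun x => (f x)%:C : (R[i])^o).
Proof.
move=> fi fm ff; split.
  apply: (@sub_finite_set _ _ (real_complex R @` (f @` D))).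
    by move=> _ [x Dx <-]; exists (f x) => //; exists x.
  exact: finite_image.
move=> v; have [v0|v0] := eqVneq (complex.Im v) 0; last first.
  rewrite (_ : _ @^-1` _ = set0) ?setI0 ?measure0; first by split.
  by apply/seteqP; split => // x /= fv; move: v0; rewrite -fv /= eqxx.
rewrite (_ : _ @^-1` _ = f @^-1` [set complex.Re v]); last first.
  apply/seteqP; split=> x /= fv; first by rewrite -fv.
  by apply: complexP => //=; rewrite v0.
split; first exact: fm.
move=> vn0; apply: ff; apply: contra vn0 => /eqP rv.
by apply/eqP/complexP; rewrite ?rv ?v0.
Qed.

Lemma bsimple_approxD (V : normedModType R[i]) (s1 s2 : nat -> T -> V) (g1 g2 : T -> V) :
  bsimple_approx mu D s1 g1 -> bsimple_approx mu D s2 g2 ->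
  bsimple_approx mu D (fun n x => s1 n x + s2 n x) (fun x => g1 x + g2 x).
Proof.
move=> [ss1 c1] [ss2 c2]; split.
  by move=> n; apply: (bsimple_op (op := +%R)) => //; rewrite addr0.
by apply: filterS2 c1 c2 => x c1 c2 Dx; apply: cvgD; [exact: c1|exact: c2].
Qed.

Lemma bsimple_approxZ (V : normedModType R[i]) (s : nat -> T -> (R[i])^o)
    (g : T -> R[i]) (v : V) :
  bsimple_approx mu D s g ->
  bsimple_approx mu D (fun n x => (s n x : R[i]) *: v) (fun x => g x *: v).
Proof.
move=> [ss c]; split.
  by move=> n; apply: (bsimple_comp (f := fun a : (R[i])^o => (a : R[i]) *: v)) => //; rewrite scale0r.
by apply: filterS c => x c Dx; apply: cvgZr_tmp; exact: c.
Qed.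

Lemma bsimple_approx_ae (V : normedModType R[i]) (s : nat -> T -> V) (g g' : T -> V) :
  {ae mu, forall x, D x -> g x = g' x} ->
  bsimple_approx mu D s g -> bsimple_approx mu D s g'.
Proof.
move=> gg' [ss c]; split => //.
by apply: filterS2 gg' c => x gg' c Dx; rewrite -gg'//; exact: c.
Qed.

Lemma bsimple_approx0 (V : normedModType R[i]) :
  bsimple_approx mu D (fun _ _ => 0 : V) (fun=> 0).
Proof.
split; first by move=> n; exact: bsimple0.
by apply: nearW => x Dx; exact: cvg_cst.
Qed.

Lemma bsimple_complex (a b : T -> R) :
  bsimple mu D (fun x => (a x)%:C : (R[i])^o) ->
  bsimple mu D (fun x => (b x)%:C : (R[i])^o) ->
  bsimple mu D (fun x => (a x)%:C + 'i%C * (b x)%:C : (R[i])^o).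
Proof.
move=> sa sb; apply: (bsimple_op (op := fun u v : (R[i])^o => u + 'i%C * (v : R[i]))) => //.
by rewrite mulr0 addr0.
Qed.

Definition l1norm (f : T -> R[i]) : \bar R :=
  (\int[mu]_(x in D) (`|complex.Re (f x)| + `|complex.Im (f x)|)%:E)%E.

Lemma cintegrable_indic (L : set T) : measurable L -> L `<=` D -> (mu L < +oo)%E ->
  cintegrable mu D (fun x => (\1_L x : R)%:C).
Proof.
move=> mL LD fL; split; last exact: integrable0.
apply/integrableP; split; first by apply/measurable_EFinP; exact: measurable_indic.
rewrite (eq_integral (EFin \o \1_L)) ?integral_indic ?setIidl// => x _.
by rewrite /= ger0_norm.
Qed.

Lemma cintegral_indic (L : set T) : measurable L -> L `<=` D ->
  cintegral mu D (fun x => (\1_L x : R)%:C) = (fine (mu L))%:C.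
Proof.
move=> mL LD; apply: complexP => /=; last by rewrite /Rintegral integral0.
by rewrite /Rintegral integral_indic// setIidl.
Qed.

(** The level set of 0 may have infinite measure; [phi 0 = 0] removes it from both the integral and
    the sum. No linearity of [phi] is involved, as [phi] only relabels the values. *)
Lemma bsimple_cintegral (V : normedModType R[i]) (s : T -> V) (phi : V -> R[i]) :
  phi 0 = 0 -> bsimple mu D s ->
  cintegrable mu D (fun x => phi (s x)) /\
  cintegral mu D (fun x => phi (s x)) =
    \sum_(v \in s @` D) (fine (mu (D `&` s @^-1` [set v])))%:C * phi v.
Proof.
move=> phi0 ss; have [fA mA] := ss.
pose h v x := phi v * (\1_(D `&` s @^-1` [set v]) x : R)%:C.
have ih v : cintegrable mu D (h v).
  have [->|v0] := eqVneq v 0.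
    by rewrite /h phi0; under eq_fun do rewrite mul0r; exact: cintegrable0.
  apply: cintegrableZ => //; have [mv /(_ v0) fv] := mA v.
  by apply: cintegrable_indic => // x [].
have E x : D x -> phi (s x) = \sum_(v <- finmap.enum_fset (fset_set (s @` D))) h v x.
  move=> Dx; rewrite (bigD1_seq (s x)) ?finmap.fset_uniq//=; last first.
    by apply: eq_trans (in_fset_set fA (s x)) (mem_set _); exists x.
  rewrite big1 ?addr0 => [|v /eqP vs].
    by rewrite /h indicE mem_set// mulr1.
  rewrite /h indicE memNset ?mulr0//=.
  by move=> [_ /esym].
split.
  have [m1 m2] := bsimple_cmeasurable phi ss.
  have [i1 i2] := cintegrable_sum mD (finmap.enum_fset (fset_set (s @` D))) ih.
  split.
    apply: eq_integrable i1 => // x; rewrite inE => Dx /=; by rewrite E.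
  apply: eq_integrable i2 => // x; rewrite inE => Dx /=; by rewrite E.
rewrite fsbig_finite// (eq_cintegral _ E) cintegral_sum//; apply: eq_bigr => v _.
have [->|v0] := eqVneq v 0.
  by rewrite /h phi0; under eq_fun do rewrite mul0r; rewrite cintegral0 mulr0.
have [mv /(_ v0) fv] := mA v.
rewrite /h cintegralZ ?cintegral_indic//; first by rewrite mulrC.
by apply: cintegrable_indic => // x [].
Qed.

(** Bochner integrability asks for simple functions that converge almost everywhere and are
    L1-Cauchy; here both come from approximating the real and the imaginary part separately. *)
Lemma l1norm_approx (f : T -> R[i]) : cintegrable mu D f ->
  exists s : nat -> T -> (R[i])^o,
    bsimple_approx mu D s f /\
    forall e : R, 0 < e -> exists N, forall n, (N <= n)%N ->
      (l1norm (fun x => (s n x - f x)%R) <= e%:E)%E.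
Proof.
move=> [f1 f2].
have [a [ia ca la]] := approximation_sfun_integrable mD f1.
have [b [ib cb lb]] := approximation_sfun_integrable mD f2.
have simple (c : {sfun T >-> R}) : mu.-integrable D (EFin \o c) ->
    bsimple mu D (fun x => (c x)%:C : (R[i])^o).
  move=> ic; apply: bsimple_real => //.
  - by apply: (@sub_finite_set _ _ (range c)) => [_ [x _ <-]|]; [exists x|exact: fimfunP].
  - exact: measurable_funTS.
  - move=> r r0; have /integrableP[mc cfin] := ic.
    have mL : measurable (D `&` c @^-1` [set r]) by exact: measurableI.
    (* Markov's inequality on a single level set: integrability of [c] makes its measure finite when
       [r] is nonzero. *)
    have : (`|r|%:E * mu (D `&` c @^-1` [set r]) < +oo)%E.
      apply: le_lt_trans cfin; rewrite -integral_cst//.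
      have -> : (\int[mu]_(x in D `&` c @^-1` [set r]) (`|r|%:E) =
          \int[mu]_(x in D `&` c @^-1` [set r]) `|(EFin \o c) x|)%E.
        by apply: eq_integral => x; rewrite inE => -[_ /= ->].
      by apply: ge0_subset_integral => //; exact: measurableT_comp.
    rewrite -ge0_fin_numE ?mule_ge0// => fin.
    rewrite ltey; apply/eqP => E; move: fin; rewrite E.
    by rewrite gt0_muley// lte_fin normr_gt0.
exists (fun n x => (a n x)%:C + 'i%C * (b n x)%:C); split.
  split; first by move=> n; apply: bsimple_complex; exact: simple.
  apply: nearW => x Dx; rewrite [f x]complexE; apply: cvg_complex.
    by have /fine_cvgP[] := ca x Dx.
  by have /fine_cvgP[] := cb x Dx.
have mab : (forall n, measurable_fun D (fun x => `|(complex.Re (f x))%:E - (a n x)%:E|)%E)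
         * (forall n, measurable_fun D (fun x => `|(complex.Im (f x))%:E - (b n x)%:E|)%E).
  split=> n; apply: measurableT_comp => //; apply: emeasurable_funB; apply/measurable_EFinP.
  - by case: (cintegrable_meas (conj f1 f2)).
  - exact: measurable_funTS.
  - by case: (cintegrable_meas (conj f1 f2)).
  - exact: measurable_funTS.
have lim : (\int[mu]_(x in D) `|(complex.Re (f x))%:E - (a n x)%:E| +
            \int[mu]_(x in D) `|(complex.Im (f x))%:E - (b n x)%:E|)%E @[n --> \oo] --> 0%E.
  by rewrite -[0%E]adde0; apply: cvgeD.
move=> e e0; have /fine_cvgP[lfin /cvgrPdist_lt /(_ e e0) lt] := lim.
have [N _ hN] := filterI lfin lt; exists N => n /hN[/= lf].
rewrite sub0r normrN => /ltW /(le_trans (ler_norm _)).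
rewrite -lee_fin fineK//; apply: le_trans.
rewrite -ge0_integralD//; do ?[exact: mab.1|exact: mab.2].
rewrite le_eqVlt; apply/orP; left; apply/eqP; apply: eq_integral => x _.
rewrite -EFinD [`|complex.Re (f x) - _|]distrC [`|complex.Im (f x) - _|]distrC.
have -> : complex.Re ((a n x)%:C + 'i%C * (b n x)%:C - f x) = a n x - complex.Re (f x).
  by rewrite !(ReD, ReN, ReM) /= !(mul0r, mulr0, mul1r, subr0, addr0, oppr0).
have -> // : complex.Im ((a n x)%:C + 'i%C * (b n x)%:C - f x) = b n x - complex.Im (f x).
by rewrite !(ImD, ImN, ImM) /= !(mul0r, mulr0, mul1r, subr0, addr0, add0r, oppr0).
Qed.

(** Fatou's lemma on the complement of the exceptional null set, for a bound valid only from index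
    [N] on. *)
Lemma ge0_fatou_le (f : nat -> T -> R) (g : T -> R) (c : R) (N : nat) :
  (forall n, measurable_fun D (f n)) -> measurable_fun D g ->
  (forall n x, 0 <= f n x) -> (forall x, 0 <= g x) ->
  {ae mu, forall x, D x -> f n x @[n --> \oo] --> g x} ->
  (forall n, (N <= n)%N -> (\int[mu]_(x in D) (f n x)%:E <= c%:E)%E) ->
  (\int[mu]_(x in D) (g x)%:E <= c%:E)%E.
Proof.
move=> mf mg f0 g0 [Z [mZ Z0 fg]] fc.
have fg' x : (D `\` Z) x -> f n x @[n --> \oo] --> g x.
  move=> [Dx nZ]; apply: contrapT => nfg; apply: nZ; apply: fg => /= h.
  by apply: nfg; exact: h.
have mDZ : measurable (D `\` Z) by exact: measurableD.
rewrite (ge0_negligible_integral mZ)//; first last.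
- by move=> x _; rewrite lee_fin.
- exact/measurable_EFinP.
(* Shifting by [N] makes the bound hold at every index without changing the limit. *)
pose u n := (\int[mu]_(x in D `\` Z) (f (n + N)%N x)%:E)%E.
have -> : (\int[mu]_(x in D `\` Z) (g x)%:E =
    \int[mu]_(x in D `\` Z) limn_einf (fun n => (f (n + N)%N x)%:E))%E.
  apply: eq_integral => x; rewrite inE => Dx.
  rewrite (cvg_limn_einf_sup (l := (g x)%:E))//.
  by apply: cvg_EFin; [exact: nearW|rewrite (cvg_shiftn N (fun n => f n x)); exact: fg'].
apply: le_trans (fatou _ _ _ _) _ => //.
- by move=> n; apply/measurable_EFinP; exact: measurable_funS (mf _).
- by move=> n x _; rewrite lee_fin.
have uc n : (u n <= c%:E)%E.
  apply: le_trans (fc (n + N)%N (leq_addl _ _)).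
  apply: ge0_subset_integral => //; first exact/measurable_EFinP.
  by move=> x _; rewrite lee_fin.
rewrite limn_einf_lim; apply: lime_le; first exact: is_cvg_einfs.
apply: nearW => n; apply: le_trans (uc n); apply: ereal_inf_lbound.
by exists n => /=.
Qed.

End SimpleFunctions.

Section Bochner.
Context {R : realType} {disp : measure_display} {T : measurableType disp}.
Variables (mu : {measure set T -> \bar R}) (D : set T) (mD : measurable D).

Lemma l1norm_ge_Re (f : T -> R[i]) : cintegrable mu D f ->
  (`|complex.Re (cintegral mu D f)|%:E <= l1norm mu D f)%E /\
  (`|complex.Im (cintegral mu D f)|%:E <= l1norm mu D f)%E.
Proof.
move=> [f1 f2]; have [m1 m2] := cintegrable_meas (conj f1 f2).
have m12 : measurable_fun D (fun x => (`|complex.Re (f x)| + `|complex.Im (f x)|)%:E).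
  by apply/measurable_EFinP/measurable_funD; exact: measurableT_comp.
split=> /=.
  apply: le_trans (_ : (\int[mu]_(x in D) `|complex.Re (f x)|%:E <= _)%E).
    have := le_normr_Rintegral mD f1; rewrite -lee_fin => /le_trans; apply.
    by rewrite /Rintegral fineK// (integrable_fin_num mD (integrable_abse f1)).
  apply: ge0_le_integral => //; first exact/measurable_EFinP/measurableT_comp.
  by move=> x _; rewrite lee_fin lerDl.
apply: le_trans (_ : (\int[mu]_(x in D) `|complex.Im (f x)|%:E <= _)%E).
  have := le_normr_Rintegral mD f2; rewrite -lee_fin => /le_trans; apply.
  by rewrite /Rintegral fineK// (integrable_fin_num mD (integrable_abse f2)).
apply: ge0_le_integral => //; first exact/measurable_EFinP/measurableT_comp.
by move=> x _; rewrite lee_fin lerDr.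
Qed.

Lemma bsimple_norm (V : normedModType R[i]) (s : T -> V) : bsimple mu D s ->
  measurable_fun D (fun x => (complex.Re `|s x|)%:E).
Proof.
move=> ss; apply/measurable_EFinP.
exact: (bsimple_measurable (fun v => complex.Re `|v|) ss).
Qed.

Lemma bsimpleB (V : normedModType R[i]) (s1 s2 : T -> V) :
  bsimple mu D s1 -> bsimple mu D s2 -> bsimple mu D (fun x => s1 x - s2 x).
Proof. by move=> ss1 ss2; apply: (bsimple_op (op := fun u v => u - v)) => //; rewrite subr0. Qed.

Lemma is_bochner_integral_ae (V : normedModType R[i]) (g g' : T -> V) (I : V) :
  {ae mu, forall x, D x -> g x = g' x} ->
  is_bochner_integral mu D g I -> is_bochner_integral mu D g' I.
Proof.
by move=> gg' [s [sg sC sI]]; exists s; split => //; exact: bsimple_approx_ae gg' sg.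
Qed.

(** * Bochner integrals with values in a dual space, tested at vectors *)

Section Dual.
Context {K : numFieldType} {s' : {rmorphism K -> R[i]}} {E : normedModType K}.
Local Notation V := (bslin s' E (R[i])^o).

Lemma bsimple_integral_eval (s : T -> V) (h : E) : bsimple mu D s ->
  bsimple_integral mu D s h = cintegral mu D (fun x => s x h).
Proof.
move=> ss; have [_ ->] := @bsimple_cintegral _ _ _ mu D mD V s (fun v => v h) erefl ss.
have [fA _] := ss; rewrite /bsimple_integral !fsbig_finite//=.
elim: (finmap.enum_fset _) => [|v r IH]; first by rewrite !big_nil.
by rewrite !big_cons addbslinE scalebslinE IH.
Qed.

Lemma bslin_evalB (v w : V) (h : E) : (v - w) h = (v h : R[i]) - w h.
Proof. exact: subbslinE. Qed.

Lemma bslin_eval_le (v : V) (h : E) :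
  complex.Re `|v h : R[i]| <= complex.Re `|s' `|h| | * complex.Re `|v|.
Proof.
rewrite -lecR real_complexM Re_normcK Re_normcK norm_ReK.
exact: (bslin_le v h).
Qed.

(* By Fatou's lemma the Cauchy condition on the approximants bounds their L1
   distance to the limit. *)
Lemma is_bochner_integral_eval (g : T -> V) (I : V) (h : E) (gam : T -> R[i]) :
  is_bochner_integral mu D g I -> cintegrable mu D gam ->
  {ae mu, forall x, D x -> g x h = gam x} -> I h = cintegral mu D gam.
Proof.
move=> [s [[ss sg] sC sI]] igam ggam.
set C := complex.Re `|s' `|h| |; have C0 : 0 <= C by exact: Re_normc_ge0.
pose sh n x : R[i] := s n x h.
have ish n : cintegrable mu D (sh n).
  by have [] := @bsimple_cintegral _ _ _ mu D mD V (s n) (fun v => v h) erefl (ss n).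
(* The factor 2 compares [l1c] with the modulus, and [C] bounds evaluation at [h] by the dual
   norm. *)
have L1 (e : R) : 0 < e -> exists N, forall n, (N <= n)%N ->
    (l1norm mu D (fun x => (sh n x - gam x)%R) <= (2 * C * e)%:E)%E.
  move=> e0; have [N hN] := sC e e0; exists N => m Nm.
  pose d (k : nat) x : R[i] := sh m x - sh k x.
  have md k : cmeasurable D (d k).
    exact: cmeasurableB (cintegrable_meas (ish m)) (cintegrable_meas (ish k)).
  have mg : cmeasurable D (fun x => sh m x - gam x).
    exact: cmeasurableB (cintegrable_meas (ish m)) (cintegrable_meas igam).
  have mn f : cmeasurable D f ->
      measurable_fun D (fun x => `|complex.Re (f x)| + `|complex.Im (f x)|).
    by move=> [f1 f2]; apply: measurable_funD; exact: measurableT_comp.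
  apply: (@ge0_fatou_le _ _ _ mu D mD
      (fun k x => `|complex.Re (d k x)| + `|complex.Im (d k x)|) _ _ N).
  - by move=> k; exact: mn.
  - exact: mn.
  - by move=> k x; rewrite addr_ge0.
  - by move=> x; rewrite addr_ge0.
  - apply: filterS2 sg ggam => x sg ggam Dx; apply/cvgrPdist_lt => e1 e10.
    have C1 : 0 < 2 * C + 1 by rewrite ltr_wpDl// mulr_ge0.
    have e2 : 0 < (e1 / (2 * C + 1))%:C by rewrite ltcR divr_gt0.
    have /cvgrPdist_lt /(_ _ e2) := sg Dx; apply: filterS => k.
    rewrite -(norm_ReK (g x - s k x)) ltcR ltr_pdivlMr// => lt.
    apply: le_lt_trans (dist_l1c_le (sh m x - gam x) (d k x)) _.
    rewrite /d opprB addrC subrKA -l1cN opprB -ggam//.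
    apply: le_lt_trans (l1c_le _) _; rewrite /sh -bslin_evalB.
    have := bslin_eval_le (g x - s k x) h; rewrite -/C.
    have := Re_norm_ge0 (g x - s k x).
    set r1 := complex.Re _ in lt *; set r2 := complex.Re _ => r10 le.
    by apply: le_lt_trans lt; nra.
  - move=> k Nk.
    apply: le_trans (_ : (\int[mu]_(x in D)
        ((2 * C)%:E * (complex.Re `|s m x - s k x|)%:E) <= _)%E).
      apply: ge0_le_integral => //.
      + exact/measurable_EFinP/mn.
      + by apply: measurable_funeM; exact/bsimple_norm/bsimpleB.
      + move=> x _; rewrite -EFinM lee_fin -mulrA.
        apply: le_trans (l1c_le _) _.
        by rewrite ler_wpM2l// /d /sh -bslin_evalB; exact: bslin_eval_le.
    rewrite ge0_integralZl//.
    + rewrite [(2 * C * e)%:E]EFinM; apply: lee_wpmul2l; first by rewrite lee_fin mulr_ge0.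
      exact: hN.
    + exact/bsimple_norm/bsimpleB.
    + by move=> x _; rewrite lee_fin Re_norm_ge0.
    + by rewrite lee_fin mulr_ge0.
have conv (e : R) : 0 < e -> exists N, forall n, (N <= n)%N ->
   complex.Re `|I h - cintegral mu D (sh n)| <= C * e.
  move=> e0; have eC : 0 < e%:C by rewrite ltcR.
  have /cvgrPdist_lt /(_ _ eC)[N _ hN] := sI; exists N => n /hN /= lt.
  rewrite -bsimple_integral_eval//.
  apply: le_trans (bslin_eval_le (I - bsimple_integral mu D (s n)) h) _.
  by rewrite ler_wpM2l// -lecR norm_ReK ltW.
(* [phi] stands for the real or the imaginary part. *)
have main (phi : R[i] -> R) : (forall a b, phi (a + b) = phi a + phi b) ->
    (forall a, `|phi a| <= complex.Re `|a|) ->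
    (forall f, cintegrable mu D f -> (`|phi (cintegral mu D f)|%:E <= l1norm mu D f)%E) ->
    phi (I h - cintegral mu D gam) = 0.
  move=> phiD phin phil; apply/eqP; rewrite -normr_le0.
  apply/ler_addgt0Pr => e e0; rewrite add0r.
  (* [conv] contributes the factor [C] and [L1] the factor [2 * C]; the [+ 1] covers [C = 0]. *)
  have e'0 : 0 < e / (3 * C + 1) by rewrite divr_gt0// ltr_wpDl// mulr_ge0.
  have [N1 h1] := L1 _ e'0; have [N2 h2] := conv _ e'0.
  have {h1} := h1 _ (leq_maxl N1 N2); have {h2} := h2 _ (leq_maxr N1 N2).
  set n := maxn N1 N2 => h2 h1.
  have -> : I h - cintegral mu D gam =
    (I h - cintegral mu D (sh n)) + cintegral mu D (fun x => sh n x + -1 * gam x).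
    rewrite cintegralD ?cintegralZ//; last exact: cintegrableZ.
    by rewrite mulN1r; ring.
  rewrite phiD (le_trans (ler_normD _ _))//.
  have {}h1 : `|phi (cintegral mu D (fun x => sh n x + -1 * gam x))| <= 2 * C * (e / (3 * C + 1)).
    rewrite -lee_fin; apply: le_trans (phil _ _) _.
      by apply: cintegrableD => //; exact: cintegrableZ.
    by under eq_fun do rewrite mulN1r.
  apply: le_trans (lerD (le_trans (phin _) h2) h1) _.
  set r := e / _ in e'0 *; have -> : e = (3 * C + 1) * r.
    by rewrite /r mulrC divfK// gt_eqF// ltr_wpDl// mulr_ge0.
  lra.
apply/eqP; rewrite -subr_eq0; apply/eqP; apply: complexP.
  apply: (main (@complex.Re R)) => [|a|f /l1norm_ge_Re[]//]; [exact: ReD|exact: ler_Re_norm].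
apply: (main (@complex.Im R)) => [|a|f /l1norm_ge_Re[]//]; [exact: ImD|].
rewrite -ler_sqr ?nnegrE ?Re_normc_ge0//.
by rewrite Re_norm_sqr real_normK ?num_real// lerDr sqr_ge0.
Qed.

Lemma is_bochner_integral0 : is_bochner_integral mu D (fun=> 0 : V) 0.
Proof.
exists (fun _ _ => 0); split; first exact: bsimple_approx0.
  move=> e e0; exists 0%N => m n _ _; under eq_integral do rewrite subrr normr0.
  by rewrite integral0 lee_fin ltW.
rewrite (_ : bsimple_integral _ _ _ = 0); first exact: cvg_cst.
apply: bslinP0 => h; rewrite bsimple_integral_eval; last exact: bsimple0.
by rewrite -[LHS]/(cintegral mu D (fun=> 0)) cintegral0.
Qed.

Lemma is_bochner_integralD (g1 g2 : T -> V) (I1 I2 : V) :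
  is_bochner_integral mu D g1 I1 -> is_bochner_integral mu D g2 I2 ->
  is_bochner_integral mu D (fun x => g1 x + g2 x) (I1 + I2).
Proof.
move=> [s1 [a1 c1 i1]] [s2 [a2 c2 i2]]; have [ss1 _] := a1; have [ss2 _] := a2.
exists (fun n x => s1 n x + s2 n x); split; first exact: bsimple_approxD.
  move=> e e0; have e2 : 0 < e / 2 by rewrite divr_gt0.
  have [N1 h1] := c1 _ e2; have [N2 h2] := c2 _ e2.
  exists (maxn N1 N2) => m n; rewrite !geq_max => /andP[m1 m2] /andP[n1 n2].
  apply: le_trans (_ : (\int[mu]_(x in D)
      ((complex.Re `|s1 m x - s1 n x|)%:E + (complex.Re `|s2 m x - s2 n x|)%:E) <= _)%E).
    apply: ge0_le_integral => //.
    - by move=> x _; rewrite lee_fin Re_norm_ge0.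
    - by apply/bsimple_norm/bsimpleB; apply: (bsimple_op (op := +%R)) => //; rewrite addr0.
    - by apply: emeasurable_funD; exact/bsimple_norm/bsimpleB.
    - move=> x _; rewrite -EFinD lee_fin -lecR real_complexD !norm_ReK.
      by rewrite opprD addrACA ler_normD.
  rewrite ge0_integralD//; last 4 first.
  - by move=> x _; rewrite lee_fin Re_norm_ge0.
  - exact/bsimple_norm/bsimpleB.
  - by move=> x _; rewrite lee_fin Re_norm_ge0.
  - exact/bsimple_norm/bsimpleB.
  by rewrite (splitr e) EFinD; apply: leeD; [exact: h1|exact: h2].
rewrite (_ : (fun n => _) = (fun n => bsimple_integral mu D (s1 n) + bsimple_integral mu D (s2 n))).
  exact: cvgD.
apply/funext => n; apply: bslinP0 => h; rewrite addbslinE !bsimple_integral_eval//.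
  rewrite -cintegralD//.
  - by have [] := @bsimple_cintegral _ _ _ mu D mD V (s1 n) (fun v => v h) erefl (ss1 n).
  - by have [] := @bsimple_cintegral _ _ _ mu D mD V (s2 n) (fun v => v h) erefl (ss2 n).
by apply: (bsimple_op (op := +%R)) => //; rewrite addr0.
Qed.

(** Scalar simple functions approximating [g] in L1 are multiplied by the fixed vector [z], which
    reduces the vector-valued integral to a scalar one. *)
Lemma is_bochner_integralZ (g : T -> R[i]) (z : V) : cintegrable mu D g ->
  is_bochner_integral mu D (fun x => g x *: z) (cintegral mu D g *: z).
Proof.
move=> ig; have [s [as_ ls]] := l1norm_approx mD ig; have [ss _] := as_.
have is_ n : cintegrable mu D (s n : T -> R[i]).
  by have [] := @bsimple_cintegral _ _ _ mu D mD _ (s n) (fun v : (R[i])^o => v : R[i]) erefl (ss n).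
have mg := cintegrable_meas ig.
have mB n : measurable_fun D (fun x => (l1c (s n x - g x))%:E).
  have [m1 m2] := cmeasurableB (cintegrable_meas (is_ n)) mg.
  by apply/measurable_EFinP/measurable_funD; exact: measurableT_comp.
set Z := complex.Re `|z|; have Z0 : 0 <= Z by exact: Re_norm_ge0.
exists (fun n x => (s n x : R[i]) *: z); split; first exact: bsimple_approxZ.
  move=> e e0; have Z1 : 0 < 2 * Z + 1 by rewrite ltr_wpDl// mulr_ge0.
  (* Two approximants are compared through [g], and each distance is multiplied by the norm [Z]. *)
  have e2 : 0 < e / (2 * Z + 1) by rewrite divr_gt0.
  have [N hN] := ls _ e2; exists N => m n Nm Nn.
  have sz k : bsimple mu D (fun x => (s k x : R[i]) *: z).
    by apply: (bsimple_comp (f := fun a : (R[i])^o => (a : R[i]) *: z)) => //; rewrite scale0r.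
  apply: le_trans (_ : (\int[mu]_(x in D)
      (Z%:E * ((l1c (s m x - g x)%R)%:E + (l1c (s n x - g x)%R)%:E)) <= _)%E).
    apply: ge0_le_integral => //.
    - by move=> x _; rewrite lee_fin Re_norm_ge0.
    - exact/bsimple_norm/bsimpleB.
    - by apply/measurable_funeM/emeasurable_funD.
    - move=> x _; rewrite -EFinD -EFinM lee_fin -scalerBl normrZ.
      rewrite -(Re_normcK (s m x - s n x)) -(norm_ReK z) -real_complexM /= mulrC ler_wpM2l//.
      apply: le_trans (norm_le_l1c _) _.
      have -> : s m x - s n x = (s m x - g x) + - (s n x - g x) :> R[i] by ring.
      by apply: le_trans (l1cD_le _ _) _; rewrite l1cN.
  have l0 a : (0 <= (l1c a)%:E)%E by rewrite lee_fin addr_ge0.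
  rewrite ge0_integralZl//; last first.
  - by move=> x Dx; apply: adde_ge0; exact: l0.
  - exact: emeasurable_funD.
  rewrite ge0_integralD//.
  apply: le_trans (_ : (Z%:E * ((e / (2 * Z + 1))%:E + (e / (2 * Z + 1))%:E) <= _)%E).
    apply: lee_wpmul2l; first by rewrite lee_fin.
    by apply: leeD; exact: hN.
  rewrite -EFinD -EFinM lee_fin.
  set r := e / _ in e2 *; have -> : e = (2 * Z + 1) * r by rewrite /r mulrC divfK// gt_eqF.
  lra.
rewrite (_ : (fun n => _) = (fun n => cintegral mu D (s n : T -> R[i]) *: z)).
  apply: cvgZr_tmp; apply/cvgrPdist_lt => e; rewrite ltcE /= => /andP[/eqP e1 e0].
  (* The two parts are at most a third each, so the modulus is at most two thirds of [e], strictly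
     less than [e]. *)
  have e3 : 0 < complex.Re e / 3 by rewrite divr_gt0.
  have [N hN] := ls _ e3; exists N => // n /= /hN.
  have -> : (fun x => s n x - g x) = (fun x => s n x + -1 * g x) :> (T -> R[i]).
    by apply/funext => x; rewrite mulN1r.
  have iB : cintegrable mu D (fun x => s n x + -1 * g x).
    by apply: cintegrableD => //; exact: cintegrableZ.
  have [lr li] := l1norm_ge_Re iB.
  have -> : cintegral mu D g - cintegral mu D (s n : T -> R[i]) =
      - cintegral mu D (fun x => (s n x : R[i]) + -1 * g x).
    by rewrite cintegralD ?cintegralZ//; [ring|exact: cintegrableZ].
  move=> le; move: (le_trans lr le) (le_trans li le); rewrite !lee_fin normrN => r1 r2.
  apply: le_lt_trans (normc_le_ReIm r1 r2) _.
  by rewrite ltcE /= e1 eqxx /=; lra.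
apply/funext => n; apply: bslinP0 => h; rewrite scalebslinE bsimple_integral_eval.
  under eq_cintegral do rewrite scalebslinE -[_ *: _]/(_ * _) mulrC.
  by rewrite cintegralZ// mulrC.
by apply: (bsimple_comp (f := fun a : (R[i])^o => (a : R[i]) *: z)) => //; rewrite scale0r.
Qed.

Lemma is_bochner_integral_sum (J : Type) (r : seq J) (g : J -> T -> V) (I : J -> V) :
  (forall j, is_bochner_integral mu D (g j) (I j)) ->
  is_bochner_integral mu D (fun x => \sum_(j <- r) g j x) (\sum_(j <- r) I j).
Proof.
move=> gI; elim: r => [|j r IH].
  by under eq_fun do rewrite big_nil; rewrite big_nil; exact: is_bochner_integral0.
by under eq_fun do rewrite big_cons; rewrite big_cons; exact: is_bochner_integralD.
Qed.
End Dual.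
End Bochner.

(** * Square-integrable vector-valued functions on a sigma-finite space *)

Section Approximation.
Context {R : realType} {disp : measure_display} {T : measurableType disp}.
Variables (mu : {sigma_finite_measure set T -> \bar R}) (D : set T).
Hypothesis mD : measurable D.

(** On a space of infinite measure a square-integrable function need not be integrable, so
    [l1norm_approx] does not apply to it. Cutting off on these sets gives simple approximants
    supported on sets of finite measure. *)
Lemma sigma_finite_exhaustion : exists G : nat -> set T,
  [/\ forall n, measurable (G n), forall n, (mu (G n) < +oo)%E &
      forall x, \forall n \near \oo, G n x].
Proof.
have [F TF FP] := sigma_finiteT mu.
have mF n : measurable (F n) by case: (FP n).
exists (fun n => \bigcup_(k in `I_n) F k); split=> [n|n|x].
- exact: bigcup_measurable.
- apply: le_lt_trans (content_sub_fsum mu (finite_II n) _ _ (@subset_refl _ _)) _ => //.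
    exact: bigcup_measurable.
  rewrite fsbig_finite//=; apply: lte_sum_pinfty => k _; by case: (FP k).
- have [k _ Fk] : (\bigcup_i F i) x by rewrite -TF.
  by exists k.+1 => // n /= kn; exists k.
Qed.

Lemma cmeasurable_approx (f : T -> R[i]) : cmeasurable D f ->
  exists s : nat -> T -> (R[i])^o, (forall n, bsimple mu D (s n)) /\
    forall x, D x -> s n x @[n --> \oo] --> (f x : (R[i])^o).
Proof.
move=> [f1 f2]; have [G [mG fG GT]] := sigma_finite_exhaustion.
have [a ca] := approximation_sfun mD (proj2 (measurable_EFinP _ _) f1).
have [b cb] := approximation_sfun mD (proj2 (measurable_EFinP _ _) f2).
have simple (c : {sfun T >-> R}) n :
    bsimple mu D (fun x => (c x * \1_(G n) x)%:C : (R[i])^o).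
  have mc : measurable_fun D (fun x => c x * \1_(G n) x).
    by apply: measurable_funM; [exact: measurable_funTS|exact: measurable_indic].
  apply: bsimple_real => //.
  - apply: (@sub_finite_set _ _ (range c `|` [set 0])).
      move=> _ [x _ <-]; rewrite indicE; case: (x \in G n).
        by left; exists x => //; rewrite mulr1.
      by right; rewrite /= mulr0.
    by rewrite finite_setU; split => //; exact: fimfunP.
  - move=> r r0; apply: le_lt_trans (fG n); apply: le_measure; rewrite ?inE//.
      exact: mc.
    move=> x [_ /= xr]; apply: contrapT => nG; move: r0; rewrite -xr indicE.
    by rewrite memNset// mulr0 eqxx.
exists (fun n x => (a n x * \1_(G n) x)%:C + 'i%C * (b n x * \1_(G n) x)%:C).
split; first by move=> n; apply: bsimple_complex.
move=> x Dx; rewrite [f x]complexE.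
have lim (c : nat -> T -> R) (l : R) : c n x @[n --> \oo] --> l ->
    (c n x * \1_(G n) x) @[n --> \oo] --> l.
  apply: cvg_trans; apply: near_eq_cvg; apply: filterS (GT x) => n Gx.
  by rewrite indicE mem_set// mulr1.
apply: cvg_complex.
  by apply: (lim (fun n => a n)); have /fine_cvgP[] := ca x Dx.
by apply: (lim (fun n => b n)); have /fine_cvgP[] := cb x Dx.
Qed.

(** By the reverse triangle inequality the norm of the limit is the pointwise limit of the norms of
    the simple functions. *)
Lemma measurable_norm_lim (V : normedModType R[i]) (s : nat -> T -> V) (g : T -> V) :
  (forall n, bsimple mu D (s n)) -> (forall x, D x -> s n x @[n --> \oo] --> g x) ->
  measurable_fun D (fun x => complex.Re `|g x|).
Proof.
move=> ss sg; apply: (@measurable_fun_cvg _ _ _ D (fun n x => complex.Re `|s n x|)).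
  by move=> n; apply/measurable_EFinP; exact: bsimple_norm (ss n).
move=> x /sg /cvgrPdist_lt gx; apply/cvgrPdist_lt => e e0.
have e1 : 0 < e%:C by rewrite ltcR.
apply: filterS (gx _ e1) => n; rewrite -(norm_ReK (g x - s n x)) ltcR; apply: le_lt_trans.
have le (u v : V) : complex.Re `|u| <= complex.Re `|u - v| + complex.Re `|v|.
  by rewrite -lecR real_complexD !norm_ReK -{1}(subrK v u) ler_normD.
have := le (g x) (s n x); have := le (s n x) (g x); rewrite (distrC (s n x)).
by rewrite ler_norml => h1 h2; apply/andP; split; lra.
Qed.

Lemma bochner_L2_sum (V : normedModType R[i]) (I : Type) (r : seq I)
    (g : I -> T -> R[i]) (v : I -> V) :
  (forall i, L2 mu D (g i)) ->
  bochner_L2 mu D (fun x => \sum_(i <- r) g i x *: v i).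
Proof.
move=> g2.
have mg i : cmeasurable D (g i) by exact: L2_cmeasurable (g2 i).
pose N (h : T -> V) x := complex.Re `|h x|.
have N0 h x : (0 <= (N h x ^+ 2)%:E)%E by rewrite lee_fin sqr_ge0.
(* The induction carries convergence everywhere on [D], the form that [measurable_norm_lim]
   requires. *)
suff [s [ss sg] fin] : exists2 s : nat -> T -> V,
    (forall n, bsimple mu D (s n)) /\
    (forall x, D x -> s n x @[n --> \oo] --> \sum_(i <- r) g i x *: v i) &
    (\int[mu]_(x in D) (N (fun x => \sum_(i <- r) g i x *: v i) x ^+ 2)%:E < +oo)%E.
  by split=> //; exists s; split => //; exact: nearW.
elim: r => [|i r [s [ss sg] fin]].
  exists (fun _ _ => 0); first split.
  - by move=> n; exact: bsimple0.
  - by move=> x Dx; rewrite big_nil; exact: cvg_cst.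
  - by rewrite /N; under eq_integral do rewrite big_nil normr0 expr0n; rewrite integral0.
have [t [st tg]] := cmeasurable_approx (mg i).
have stv n : bsimple mu D (fun x => (t n x : R[i]) *: v i).
  by apply: (bsimple_comp (f := fun a : (R[i])^o => (a : R[i]) *: v i)) => //; rewrite scale0r.
have tgv x : D x -> ((t n x : R[i]) *: v i) @[n --> \oo] --> g i x *: v i.
  by move=> Dx; apply: cvgZr_tmp; exact: tg.
exists (fun n x => (t n x : R[i]) *: v i + s n x); first split.
- by move=> n; apply: (bsimple_op (op := +%R)) => //; rewrite addr0.
- by move=> x Dx; rewrite big_cons; apply: cvgD; [exact: tgv|exact: sg].
pose g1 x := g i x *: v i; pose g3 x := \sum_(i <- r) g i x *: v i.
have m1 : measurable_fun D (fun x => (N g1 x ^+ 2)%:E).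
  by apply/measurable_EFinP/measurable_funX; exact: measurable_norm_lim stv tgv.
have m3 : measurable_fun D (fun x => (N g3 x ^+ 2)%:E).
  by apply/measurable_EFinP/measurable_funX; exact: measurable_norm_lim ss sg.
have fin1 : (\int[mu]_(x in D) (N g1 x ^+ 2)%:E < +oo)%E.
  have -> : (\int[mu]_(x in D) (N g1 x ^+ 2)%:E =
    \int[mu]_(x in D) ((complex.Re `|v i| ^+ 2)%:E * (sqnorm (g i x))%:E))%E.
    apply: eq_integral => x _; rewrite -EFinM /sqnorm -Re_norm_sqr -exprMn; congr ((_ ^+ 2)%:E).
    apply: complexI; rewrite /N norm_ReK real_complexM norm_ReK Re_normcK.
    by rewrite /g1 normrZ mulrC.
  have /L2P[_ gi2] := g2 i; rewrite ge0_integralZl//.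
  - by rewrite lte_mul_pinfty// lee_fin sqr_ge0.
  - exact: measurable_sqnorm.
  - by move=> x _; rewrite lee_fin sqnorm_ge0.
  - by rewrite lee_fin sqr_ge0.
have -> : (fun x => \sum_(j <- i :: r) g j x *: v j) = (fun x => g1 x + g3 x).
  by apply/funext => x; rewrite big_cons.
apply: le_lt_trans (_ : (\int[mu]_(x in D)
    (2%:E * (N g1 x ^+ 2)%:E + 2%:E * (N g3 x ^+ 2)%:E) < +oo)%E).
  apply: ge0_le_integral => //.
  - apply/measurable_EFinP/measurable_funX.
    apply: (@measurable_norm_lim _ (fun n x => (t n x : R[i]) *: v i + s n x)).
      by move=> n; apply: (bsimple_op (op := +%R)) => //; rewrite addr0.
    by move=> x Dx; apply: cvgD; [exact: tgv|exact: sg].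
  - by apply: emeasurable_funD; exact: measurable_funeM.
  - move=> x _; rewrite -!EFinM -EFinD lee_fin.
    have le : N (fun x => g1 x + g3 x) x <= N g1 x + N g3 x.
      by rewrite -lecR real_complexD !norm_ReK ler_normD.
    apply: le_trans (_ : (N g1 x + N g3 x) ^+ 2 <= _).
      by rewrite ler_pXn2r ?nnegrE ?addr_ge0 ?Re_norm_ge0.
    by have := sqr_ge0 (N g1 x - N g3 x); lra.
rewrite ge0_integralD//; do ?[by move=> x _; rewrite mule_ge0|exact: measurable_funeM].
by rewrite !ge0_integralZl// lte_add_pinfty// lte_mul_pinfty.
Qed.
End Approximation.

(** * Derivative of the covariance map *)

Section FrechetUnique.
Context {R : realType} {disp : measure_display} {T : measurableType disp}.
Variables (mu : {measure set T -> \bar R}) (D : set T) (mD : measurable D).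
Context {X : normedModType R} (A : set X) (F : X -> T -> R[i]) (theta : X).
Hypothesis A_open : open A.
Hypothesis A_theta : A theta.
Hypothesis F_meas : forall eta, A eta -> cmeasurable D (F eta).

Lemma frechet_L2_0 dF : frechet_L2 mu D A F theta dF ->
  {ae mu, forall x, D x -> dF 0 x = 0}.
Proof.
move=> [_ lin _ _]; apply: filterS (lin 1 0 0) => x h Dx.
by have := h Dx; rewrite scaler0 addr0 mul1r -[LHS]add0r => /addIr <-.
Qed.

Lemma frechet_L2Z dF t h : frechet_L2 mu D A F theta dF ->
  {ae mu, forall x, D x -> dF (t *: h) x = t%:C * dF h x}.
Proof.
move=> dFP; have [_ lin _ _] := dFP.
apply: filterS2 (lin t h 0) (frechet_L2_0 dFP) => x l z Dx.
by have := l Dx; rewrite addr0 z// addr0.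
Qed.

Lemma near_translate : \forall h \near (0 : X), A (theta + h).
Proof.
have : \forall x \near theta, A x by exact: open_nbhs_nbhs.
move=> /nbhs_ballP[e /= e0 eA]; apply/nbhs_ballP; exists e => // h.
rewrite -!ball_normE /= sub0r normrN => h0; apply: eA.
by rewrite -ball_normE /= opprD addNKr normrN.
Qed.

(* The two derivatives are compared at [t *: h] for small [t > 0]; the crude
   bound [sqintD_le] replaces the triangle inequality. *)
Lemma frechet_L2_unique dF dG : frechet_L2 mu D A F theta dF ->
  frechet_L2 mu D A F theta dG ->
  forall h, {ae mu, forall x, D x -> dF h x = dG h x}.
Proof.
move=> dFP dGP h; have [dF2 _ _ dFo] := dFP; have [dG2 _ _ dGo] := dGP.
have mdF k := L2_cmeasurable (dF2 k); have mdG k := L2_cmeasurable (dG2 k).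
have small (e : R) : 0 < e ->
    (sqint mu D (fun x => (dF h x - dG h x)%R) <= (4 * (e * `|h|) ^+ 2)%:E)%E.
  move=> e0; have := near_translate.
  move=> /(filterI (dFo _ e0)) /(filterI (dGo _ e0)) /nbhs_ballP[d /= d0 dP].
  (* The [+ 1] keeps [t *: h] inside the ball of radius [d] and [t] well defined also for
     [h = 0]. *)
  pose t := d / (`|h| + 1); have h1 : 0 < `|h| + 1 by rewrite ltr_wpDl.
  have t0 : 0 < t by rewrite divr_gt0.
  have th : `|t *: h| = t * `|h| by rewrite normrZ gtr0_norm.
  have [|Go [Fo Ath]] := dP (t *: h).
    rewrite -ball_normE /= sub0r normrN th /t mulrAC ltr_pdivrMr//.
    by rewrite ltr_pM2l// ltrDl.
  have c0 : 0 <= e * `|t *: h| by rewrite mulr_ge0// ltW.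
  have /(L2norm_le mu D _ c0) {}Fo := Fo Ath.
  have /(L2norm_le mu D _ c0) {}Go := Go Ath.
  have mD1 (g : T -> R[i]) : cmeasurable D g ->
      cmeasurable D (fun x => F (theta + t *: h) x - F theta x - g x).
    by move=> mg; apply: cmeasurableB mg; apply: cmeasurableB; exact: F_meas.
  (* The increments of [F] cancel: the difference of the two remainders at [t *: h] is [t] times
     [dF h - dG h]. Dividing by $t^2$ afterwards leaves a bound independent of [t]. *)
  have E : sqint mu D (fun x => t%:C * (dF h x - dG h x)) =
    sqint mu D (fun x => (F (theta + t *: h) x - F theta x - dG (t *: h) x) +
       -1 * (F (theta + t *: h) x - F theta x - dF (t *: h) x)).
    apply: sqint_ae => //.
    - exact/cmeasurableZ/cmeasurableB.
    - by apply: cmeasurableD; [exact: mD1|exact/cmeasurableZ/mD1].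
    - apply: filterS2 (frechet_L2Z t h dFP) (frechet_L2Z t h dGP) => x f1 g1 Dx.
      by rewrite f1// g1//; ring.
  have {}E : ((t ^+ 2)%:E * sqint mu D (fun x => dF h x - dG h x)%R <=
      (t ^+ 2)%:E * (4 * (e * `|h|) ^+ 2)%:E)%E.
    rewrite (_ : t ^+ 2 = sqnorm t%:C); last by rewrite /sqnorm /= expr0n addr0.
    rewrite -sqintM_cst//; last exact: cmeasurableB.
    rewrite E; apply: le_trans (sqintD_le _ _ _ _) _ => //; first exact: mD1.
      exact/cmeasurableZ/mD1.
    rewrite sqintM_cst//; last exact: mD1.
    have -> : sqnorm (-1 : R[i]) = 1.
      by rewrite /sqnorm ReN ImN /= oppr0 sqrrN expr1n expr0n addr0.
    rewrite mul1e; apply: le_trans (leeD (lee_wpmul2l _ Go) (lee_wpmul2l _ Fo)) _;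
      rewrite ?lee_fin//.
    by rewrite /sqnorm /= expr0n addr0 th; nra.
  by rewrite lee_pmul2l ?lte_fin ?exprn_gt0// in E.
have z : sqint mu D (fun x => dF h x - dG h x) = 0%E.
  apply/eqP; rewrite eq_le sqint_ge0 andbT; apply/lee_addgt0Pr => e e0; rewrite add0e.
  have h1 : 0 < `|h| + 1 by rewrite ltr_wpDl.
  have [q q0 qe] : exists2 q : R, 0 < q & q ^+ 2 = e.
    by exists (Num.sqrt e); rewrite ?sqrtr_gt0 ?sqr_sqrtr// ltW.
  (* This value [e1] satisfies $4(e_1\|h\|)^2 \le q^2 = e$. *)
  have e1 : 0 < q / (2 * (`|h| + 1)) by rewrite divr_gt0// mulr_gt0.
  apply: le_trans (small _ e1) _; rewrite lee_fin -qe.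
  have -> : 4 * (q / (2 * (`|h| + 1)) * `|h|) ^+ 2 = (q * (`|h| / (`|h| + 1))) ^+ 2.
    by field; rewrite gt_eqF.
  rewrite ler_pXn2r ?nnegrE ?mulr_ge0 ?divr_ge0 ?(ltW q0) ?(ltW h1)//.
  by rewrite ler_piMr ?(ltW q0)// ler_pdivrMr// mul1r lerDl.
apply: filterS (sqint0_ae mD _ z); last exact: cmeasurableB.
by move=> x fg Dx; apply/eqP; rewrite -subr_eq0 fg.
Qed.
End FrechetUnique.

(** * The embedding of [U] into L2 through representatives *)

Section Embedding.
Context {R : realType} {disp : measure_display} {T : measurableType disp}.
Variables (mu : {measure set T -> \bar R}) (D : set T) (mD : measurable D).
Context {U : normedModType R[i]} (j : U -> T -> R[i]).
Hypothesis hj : L2_dense_embedding mu D j.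

Lemma embed_L2 u : L2 mu D (j u).
Proof. by case: hj. Qed.

Lemma embed_meas u : cmeasurable D (j u).
Proof. exact: L2_cmeasurable (embed_L2 u). Qed.

Lemma embedP a u v : {ae mu, forall x, D x -> j (a *: u + v) x = a * j u x + j v x}.
Proof. by case: hj. Qed.

Lemma embed0 : {ae mu, forall x, D x -> j 0 x = 0}.
Proof.
apply: filterS (embedP 1 0 0) => x h Dx.
by have := h Dx; rewrite scaler0 addr0 mul1r -[LHS]add0r => /addIr <-.
Qed.

Lemma embedD u v : {ae mu, forall x, D x -> j (u + v) x = j u x + j v x}.
Proof. by apply: filterS (embedP 1 u v) => x h Dx; rewrite -[u]scale1r h// scale1r mul1r. Qed.

Lemma embedZ a u : {ae mu, forall x, D x -> j (a *: u) x = a * j u x}.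
Proof.
apply: filterS2 (embedP a u 0) embed0 => x h h0 Dx.
by have := h Dx; rewrite addr0 h0// addr0.
Qed.

Lemma embedB u v : {ae mu, forall x, D x -> j (u - v) x = j u x - j v x}.
Proof.
apply: filterS (embedP (-1) v u) => x h Dx.
by rewrite addrC -scaleN1r h// mulN1r addrC.
Qed.

Lemma embed_sum (I : Type) (r : seq I) (c : I -> R[i]) (u : I -> U) :
  {ae mu, forall x, D x ->
    j (\sum_(i <- r) c i *: u i) x = \sum_(i <- r) c i * j (u i) x}.
Proof.
elim: r => [|i r IH].
  by apply: filterS embed0 => x h Dx; rewrite !big_nil h.
apply: filterS2 IH (embedP (c i) (u i) (\sum_(i <- r) c i *: u i)) => x h h1 Dx.
by rewrite !big_cons h1// h.
Qed.

Lemma embed_inj u v : {ae mu, forall x, D x -> j u x = j v x} -> u = v.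
Proof.
move=> uv; have [_ _ _ inj _] := hj; apply/eqP; rewrite -subr_eq0; apply/eqP.
by apply: inj; apply: filterS2 uv (embedB u v) => x h h1 Dx; rewrite h1// h// subrr.
Qed.

(** Injectivity of the embedding forces the choice made in [L2_lift]. *)
Lemma L2_liftE u g : {ae mu, forall x, D x -> j u x = g x} -> L2_lift mu D j g = u.
Proof.
move=> ug; have lift : {ae mu, forall x, D x -> j (L2_lift mu D j g) x = g x}.
  by apply: (@getPex _ [set u | {ae mu, forall x, D x -> j u x = g x}]); exists u.
by apply: embed_inj; apply: filterS2 lift ug => x h h1 Dx; rewrite h// h1.
Qed.

Lemma embed_sqint : exists2 M : R, 0 <= M &
  forall u, (sqint mu D (j u) <= (M * complex.Re `|u| ^+ 2)%:E)%E.
Proof.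
(* The bound in the definition of the embedding has no prescribed sign, hence the absolute value. *)
have [_ _ [M hM] _ _] := hj; exists (`|M| ^+ 2); first exact: sqr_ge0.
move=> u; rewrite -exprMn; apply/L2norm_le.
  by rewrite mulr_ge0// Re_norm_ge0.
by apply: le_trans (hM u) _; rewrite lee_fin ler_wpM2r ?Re_norm_ge0// ler_norm.
Qed.

End Embedding.

(** * Perturbation of the parameter-to-state map *)

Section StateMap.
Context {R : realType} {U W : normedModType R[i]} {X : normedModType R}.
Variables (K : CLin U (cdual W)) (B : CLin U (RLin X (cdual W))).

Lemma CLin_le (V V' : normedModType R[i]) (f : CLin V V') v :
  complex.Re `|f v| <= opnorm f * complex.Re `|v|.
Proof.
rewrite -lecR norm_ReK real_complexM norm_ReK mulrC.
by have := bslin_le f v; rewrite /= normr_id.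
Qed.

Lemma bilinear_le u h : complex.Re `|B u h| <= opnorm B * complex.Re `|u| * `|h|.
Proof.
apply: le_trans (_ : `|h| * opnorm (B u) <= _).
  rewrite -lecR norm_ReK real_complexM.
  have := bslin_le (B u) h.
  have -> : `|(`|h|)%:C| = (`|h|)%:C :> R[i] by rewrite ger0_norm// ler0c.
  by [].
rewrite mulrC ler_wpM2r//; have := CLin_le B u.
by rewrite bslin_normE.
Qed.

Lemma stateP f theta : boundedly_invertible (model K B theta) ->
  model K B theta (state K B f theta) = f.
Proof.
move=> [A' [_ A'K]].
by apply: (@getPex _ [set u | model K B theta u = f]); exists (A' f).
Qed.

Section Perturbation.
Variables (f : cdual W) (theta : X) (A' : CLin (cdual W) U).
Hypothesis A'K : cancel (model K B theta) A'.
Hypothesis AK : cancel A' (model K B theta).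

Let u := state K B f theta.

(** The linearized state when [v] is the state at [theta]. The base point is left free because the
    exact increment of the state has the same form, taken at the perturbed state. *)
Definition dstate (v : U) (h : X) : U := - A' (B v h).

Lemma dstateP v a h k : dstate v (a *: h + k) = a%:C *: dstate v h + dstate v k.
Proof. by rewrite /dstate bslinD bslinZ bslinD bslinZ opprD scalerN. Qed.

Lemma dstate_le v h :
  complex.Re `|dstate v h| <= opnorm A' * opnorm B * complex.Re `|v| * `|h|.
Proof.
rewrite /dstate normrN; apply: le_trans (CLin_le A' _) _.
by rewrite -!mulrA ler_wpM2l ?opnorm_ge0// mulrA bilinear_le.
Qed.

Lemma model_dstate v h : model K B theta (dstate v h) = - B v h.
Proof. by rewrite /dstate bslinN AK. Qed.

(** With $v$ the perturbed state, $f = D(\theta)v + B(v)h$ because the model is affine in the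
    parameter; subtract $f = D(\theta)u$ and invert $D(\theta)$. *)
Lemma state_perturb h : boundedly_invertible (model K B (theta + h)) ->
  state K B f (theta + h) - u = dstate (state K B f (theta + h)) h.
Proof.
move=> inv; have := stateP f inv; set v := state _ _ _ _ => vf.
have uf : model K B theta u = f by apply: stateP; exists A'.
apply: (can_inj A'K); rewrite model_dstate bslinB uf -[in LHS]vf.
rewrite /= /model_fun bslinD addrA opprD addrA subrr sub0r.
by [].
Qed.

(* [state_perturb] is implicit in the perturbed state but needs only the inverse
   at [theta], so no Neumann series is required. *)
Lemma state_perturb_le h : boundedly_invertible (model K B (theta + h)) ->
  opnorm A' * opnorm B * `|h| <= 2^-1 ->
  complex.Re `|state K B f (theta + h) - u| <=
    2 * (opnorm A' * opnorm B) * complex.Re `|u| * `|h| /\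
  complex.Re `|state K B f (theta + h) - u - dstate u h| <=
    2 * (opnorm A' * opnorm B) ^+ 2 * complex.Re `|u| * `|h| ^+ 2.
Proof.
move=> inv; set c := opnorm A' * opnorm B => ch.
have c0 : 0 <= c by rewrite mulr_ge0 ?opnorm_ge0.
have E := state_perturb inv.
set v := state K B f (theta + h) in E *.
(* Absorption: $\|v\| \le \|u\| + c\|h\|\|v\| \le \|u\| + \frac12\|v\|$. *)
have vle : complex.Re `|v| <= 2 * complex.Re `|u|.
  have : complex.Re `|v| <= complex.Re `|v - u| + complex.Re `|u|.
    by rewrite -lecR real_complexD !norm_ReK -{1}(subrK u v) ler_normD.
  have := dstate_le v h; rewrite -E -/c => le.
  have : c * complex.Re `|v| * `|h| <= 2^-1 * complex.Re `|v|.
    by rewrite mulrAC ler_wpM2r ?Re_norm_ge0.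
  lra.
have le1 : complex.Re `|v - u| <= 2 * c * complex.Re `|u| * `|h|.
  rewrite E; apply: le_trans (dstate_le v h) _; rewrite -/c.
  by rewrite ler_wpM2r//; have := ler_wpM2l c0 vle; lra.
split=> //; rewrite E.
(* Linearity in the base point presents the remainder as a first-order map applied to a first-order
   increment, hence of second order. *)
have -> : dstate v h - dstate u h = dstate (v - u) h.
  have e : B (v - u) h = B v h - B u h by rewrite bslinB subbslinE.
  by rewrite /dstate e bslinB opprD.
apply: le_trans (dstate_le (v - u) h) _; rewrite -/c.
have := ler_wpM2l c0 le1; move=> /(ler_wpM2r (normr_ge0 h)) /le_trans; apply.
by rewrite le_eqVlt; apply/orP; left; apply/eqP; ring.
Qed.

End Perturbation.
End StateMap.

(** * Differentiability of the parameter-to-covariance map *)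

Section CovarianceDerivative.
Context {R : realType} {disp : measure_display} {T : measurableType disp}.
Variables (mu : {sigma_finite_measure set T -> \bar R}) (D : set T).
Hypothesis mD : measurable D.
Local Notation mu2 := (mu \x mu)%E.
Local Notation D2 := (D `*` D).
Context {U W : normedModType R[i]} {X : normedModType R} (j : U -> T -> R[i]).
Hypothesis hj : L2_dense_embedding mu D j.
Local Notation N v := (complex.Re `|v|).

Let mD2 : measurable D2. Proof. exact: measurableX. Qed.

Let sq_le (a b : R) : 0 <= a -> a <= b -> a ^+ 2 <= b ^+ 2.
Proof. by move=> a0 ab; rewrite ler_pXn2r ?nnegrE// (le_trans a0). Qed.

Lemma L2_embed_tensor (u v : U) : L2 mu2 D2 (fun z => j u z.1 * conjC (j v z.2)).
Proof.
apply: (L2_tensor mD (g := fun x => conjC (j v x))); first exact: embed_L2 hj u.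
exact/L2_conj/(embed_L2 hj).
Qed.

(** The squared L2 norm of [rho h] is $O(w(h))$ on [S]. Hiding the constant lets terms be added and
    multiplied by rate alone: $\|h\|^2$ for the derivative, $\|h\|^4$ for the remainder. *)
Definition sqbound (rho : X -> T * T -> R[i]) (w : X -> R) (S : set X) :=
  exists2 M : R, 0 <= M & forall h, S h -> cmeasurable D2 (rho h) /\
    (sqint mu2 D2 (rho h) <= (M * w h)%:E)%E.

Lemma sqboundD r1 r2 w S : sqbound r1 w S -> sqbound r2 w S ->
  sqbound (fun h z => r1 h z + r2 h z) w S.
Proof.
move=> [M1 M10 h1] [M2 M20 h2]; exists (2 * M1 + 2 * M2).
  by rewrite addr_ge0// mulr_ge0.
move=> h Sh; have [m1 b1] := h1 h Sh; have [m2 b2] := h2 h Sh.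
split; first exact: cmeasurableD.
apply: le_trans (sqintD_le mu2 mD2 m1 m2) _.
apply: le_trans (leeD (lee_wpmul2l _ b1) (lee_wpmul2l _ b2)) _; rewrite ?lee_fin//.
by lra.
Qed.

Lemma sqboundZ c r w S : sqbound r w S -> sqbound (fun h z => c * r h z) w S.
Proof.
move=> [M M0 hM]; exists (sqnorm c * M); first by rewrite mulr_ge0 ?sqnorm_ge0.
move=> h Sh; have [m b] := hM h Sh; split; first exact: cmeasurableZ.
rewrite sqintM_cst// -mulrA EFinM lee_wpmul2l ?lee_fin ?sqnorm_ge0//.
Qed.

Lemma sqbound_sum (I : Type) (s : seq I) (r : I -> X -> T * T -> R[i]) w S :
  (forall h, 0 <= w h) -> (forall i, sqbound (r i) w S) ->
  sqbound (fun h z => \sum_(i <- s) r i h z) w S.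
Proof.
move=> w0 rb; elim: s => [|i s IH].
  exists 0 => // h Sh; under eq_fun do rewrite big_nil.
  split; first exact: cmeasurable_cst.
  rewrite mul0r /sqint /sqnorm /=; under eq_integral do rewrite expr0n addr0.
  by rewrite integral0.
have [M M0 hM] := sqboundD (rb i) IH; exists M => // h Sh.
by under eq_fun do rewrite big_cons; exact: hM.
Qed.

(** The squared norm of a tensor product is the product of the squared norms, so the rates
    multiply. *)
Lemma sqbound_tensor (p q : X -> U) (w1 w2 : X -> R) (c1 c2 : R) S :
  0 <= c1 -> 0 <= c2 ->
  (forall h, S h -> N (p h) ^+ 2 <= c1 * w1 h) ->
  (forall h, S h -> N (q h) ^+ 2 <= c2 * w2 h) ->
  sqbound (fun h z => j (p h) z.1 * conjC (j (q h) z.2)) (fun h => w1 h * w2 h) S.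
Proof.
move=> c10 c20 hp hq; have [M M0 hM] := embed_sqint hj.
exists (M * c1 * (M * c2)); first by rewrite !mulr_ge0.
move=> h Sh; split; first exact/L2_cmeasurable/L2_embed_tensor.
have mp := embed_meas hj (p h); have mq := embed_meas hj (q h).
rewrite (sqint_tensor mu mD mp (cmeasurable_conj mq)).
have -> : sqint mu D (fun x => conjC (j (q h) x)) = sqint mu D (j (q h)).
  by apply: eq_integral => x _; rewrite sqnorm_conj.
rewrite mulrACA -[M * c1 * w1 h]mulrA -[M * c2 * w2 h]mulrA EFinM.
apply: lee_pmul; rewrite ?sqint_ge0//.
  by apply: le_trans (hM _) _; rewrite lee_fin ler_wpM2l// hp.
by apply: le_trans (hM _) _; rewrite lee_fin ler_wpM2l// hq.
Qed.

Variables (K : CLin U (cdual W)) (B : CLin U (RLin X (cdual W))).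
Variable A : set X.
Hypothesis A_inv : forall eta, A eta -> boundedly_invertible (model K B eta).
Variables (J : nat) (f : 'I_J -> cdual W) (theta : X).
Variables (A' : CLin (cdual W) U).
Hypothesis A'K : cancel (model K B theta) A'.
Hypothesis AK : cancel A' (model K B theta).

Let u i := state K B (f i) theta.
Let du i h := dstate B A' (u i) h.

Lemma L2_cov_map eta : L2 mu2 D2 (cov_map j K B f eta).
Proof.
by apply: L2Z => //; apply: L2_sum => // i; exact: L2_embed_tensor.
Qed.

Definition dcov (h : X) (z : T * T) : R[i] := J%:R^-1 *
  \sum_(i < J) (j (du i h) z.1 * conjC (j (u i) z.2) +
                j (u i) z.1 * conjC (j (du i h) z.2)).

Lemma L2_dcov h : L2 mu2 D2 (dcov h).
Proof.
by apply: L2Z => //; apply: L2_sum => // i; apply: L2D => //; exact: L2_embed_tensor.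
Qed.

Lemma dcov_linear a h k : {ae mu2, forall z, D2 z ->
  dcov (a *: h + k) z = a%:C * dcov h z + dcov k z}.
Proof.
(* Finitely many indices share one null set, which is then lifted to the product in either
   variable. *)
have E : {ae mu, forall x, D x -> forall i, j (du i (a *: h + k)) x =
    a%:C * j (du i h) x + j (du i k) x}.
  suff : {ae mu, forall x, forall i, D x -> j (du i (a *: h + k)) x =
    a%:C * j (du i h) x + j (du i k) x} by apply: filterS => x hx Dx i; exact: hx.
  apply: filter_forall => i; rewrite /du dstateP; exact: embedP hj _ _ _.
apply: filterS2 (ae_fst E) (ae_snd E) => z E1 E2 Dz.
rewrite /dcov [a%:C * _]mulrCA -mulrDr [a%:C * \sum_(_ < _) _]mulr_sumr.
rewrite -big_split /=; congr (_ * _).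
apply: eq_bigr => i _; rewrite E1// E2// rmorphD rmorphM /=.
(* Conjugation in the second factor fixes the real scalar, so both halves of the product rule scale
   alike. *)
have -> : conjC a%:C = a%:C :> R[i] by exact: conjc_real.
by ring.
Qed.

Lemma near_norm_lt (e : R) : 0 < e -> \forall h \near (0 : X), `|h| < e.
Proof.
move=> e0; apply/nbhs_ballP; exists e => // h.
by rewrite -ball_normE /= sub0r normrN.
Qed.

Let cst0 : 0 <= opnorm A' * opnorm B.
Proof. by rewrite mulr_ge0 ?opnorm_ge0. Qed.

Lemma du_le i h : N (du i h) ^+ 2 <= (opnorm A' * opnorm B * N (u i)) ^+ 2 * `|h| ^+ 2.
Proof.
by rewrite -exprMn; apply: sq_le; [exact: Re_norm_ge0|exact: dstate_le].
Qed.

(* With [delta = u(theta + h) - u] and [r = delta - du h], the remainder of the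
   covariance is [Cov(r, u) + Cov(u, r) + Cov(delta, delta)]. *)
Lemma frechet_dcov : frechet_L2 mu2 D2 A (cov_map j K B f) theta dcov.
Proof.
split; [exact: L2_dcov|exact: dcov_linear| |].
  have [M M0 hM] : sqbound dcov (fun h => `|h| ^+ 2) setT.
    apply/sqboundZ/sqbound_sum => [h|i]; first exact: sqr_ge0.
    apply: sqboundD.
      have := @sqbound_tensor (du i) (fun=> u i) (fun h => `|h| ^+ 2) (fun=> 1) _
        (N (u i) ^+ 2) setT (sqr_ge0 _) (sqr_ge0 _) (fun h _ => du_le i h).
      by under [X in sqbound _ X]eq_fun do rewrite mulr1; apply => h _; rewrite mulr1.
    have := @sqbound_tensor (fun=> u i) (du i) (fun=> 1) (fun h => `|h| ^+ 2)
        (N (u i) ^+ 2) _ setT (sqr_ge0 _) (sqr_ge0 _).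
    under [X in sqbound _ X]eq_fun do rewrite mul1r.
    by apply => h _; [rewrite mulr1|exact: du_le].
  exists (Num.sqrt M) => h; apply/L2norm_le; first by rewrite mulr_ge0// sqrtr_ge0.
  by rewrite exprMn sqr_sqrtr//; have [] := hM h Logic.I.
move=> e e0.
have c0 := cst0; set c := opnorm A' * opnorm B in c0 *.
(* The increments to which [state_perturb_le] applies, for all sources simultaneously. *)
pose S : set X := [set h | A (theta + h) /\ c * `|h| <= 2^-1].
pose delta i h := state K B (f i) (theta + h) - u i.
pose r i h := delta i h - du i h.
pose rho h z := J%:R^-1 * \sum_(i < J)
  (j (r i h) z.1 * conjC (j (u i) z.2) + j (u i) z.1 * conjC (j (r i h) z.2) +
   j (delta i h) z.1 * conjC (j (delta i h) z.2)) : R[i].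
have dle i h : S h -> N (delta i h) ^+ 2 <= (2 * c * N (u i)) ^+ 2 * `|h| ^+ 2.
  move=> [Ah ch]; have [le _] := state_perturb_le (f i) A'K AK (A_inv Ah) ch.
  by rewrite -exprMn; apply: sq_le le; exact: Re_norm_ge0.
have rle i h : S h -> N (r i h) ^+ 2 <= (2 * c ^+ 2 * N (u i)) ^+ 2 * `|h| ^+ 4.
  move=> [Ah ch]; have [_ le] := state_perturb_le (f i) A'K AK (A_inv Ah) ch.
  rewrite (_ : `|h| ^+ 4 = (`|h| ^+ 2) ^+ 2); last by rewrite -exprM.
  by rewrite -exprMn; apply: sq_le le; exact: Re_norm_ge0.
have [M M0 hM] : sqbound rho (fun h => `|h| ^+ 4) S.
  apply/sqboundZ/sqbound_sum => [h|i]; first exact: exprn_ge0.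
  apply: sqboundD; first apply: sqboundD.
  - have := @sqbound_tensor (r i) (fun=> u i) (fun h => `|h| ^+ 4) (fun=> 1) _
        (N (u i) ^+ 2) S (sqr_ge0 _) (sqr_ge0 _) (rle i).
    by under [X in sqbound _ X]eq_fun do rewrite mulr1; apply => h _; rewrite mulr1.
  - have := @sqbound_tensor (fun=> u i) (r i) (fun=> 1) (fun h => `|h| ^+ 4)
        (N (u i) ^+ 2) _ S (sqr_ge0 _) (sqr_ge0 _).
    under [X in sqbound _ X]eq_fun do rewrite mul1r.
    by apply => h Sh; [rewrite mulr1|exact: rle].
  - have := @sqbound_tensor (delta i) (delta i) _ _
        _ _ S (sqr_ge0 _) (sqr_ge0 _) (dle i) (dle i).
    by under [X in sqbound _ X]eq_fun do rewrite -exprD.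
have M1 : 0 < M + 1 by rewrite ltr_wpDl.
have c1 : 0 < 2 * c + 1 by rewrite ltr_wpDl// mulr_ge0.
(* Since $M \le (M+1)^2$, the condition $\|h\|(M+1) < e$ turns the bound $M\|h\|^4$ into
   $e^2\|h\|^2$. *)
have e1 : 0 < e / (M + 1) by rewrite divr_gt0.
(* Within this radius $c\|h\| \le c/(2c+1) \le \frac12$, as membership in [S] demands. *)
have c2 : 0 < (2 * c + 1)^-1 by rewrite invr_gt0.
apply: filterS2 (near_norm_lt e1) (near_norm_lt c2) => h.
rewrite ltr_pdivlMr// => hM1 hc Ah.
have Sh : S h.
  split=> //; have := ler_wpM2l c0 (ltW hc); move=> /le_trans; apply.
  by rewrite ler_pdivrMr//; lra.
have [mr br] := hM h Sh.
apply/L2norm_le; first by rewrite mulr_ge0// ltW.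
rewrite (sqint_ae mD2 _ mr).
- apply: le_trans br _; rewrite lee_fin exprMn.
  rewrite (_ : `|h| ^+ 4 = `|h| ^+ 2 * `|h| ^+ 2); last by rewrite -exprD.
  rewrite mulrA ler_wpM2r ?sqr_ge0//.
  have h0 := normr_ge0 h.
  have : `|h| ^+ 2 * (M + 1) ^+ 2 <= e ^+ 2.
    by rewrite -exprMn; apply: sq_le; [rewrite mulr_ge0// ltW|rewrite ltW].
  have := sqr_ge0 `|h|; nra.
- by apply/cmeasurableB; [apply: cmeasurableB|];
    apply: L2_cmeasurable; [exact: L2_cov_map|exact: L2_cov_map|exact: L2_dcov].
- have E : {ae mu, forall x, D x -> forall i,
      j (state K B (f i) (theta + h)) x = j (u i) x + j (delta i h) x /\
      j (r i h) x = j (delta i h) x - j (du i h) x}.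
    suff : {ae mu, forall x, forall i, D x ->
      j (state K B (f i) (theta + h)) x = j (u i) x + j (delta i h) x /\
      j (r i h) x = j (delta i h) x - j (du i h) x}.
      by apply: filterS => x hx Dx i; exact: hx.
    apply: filter_forall => i.
    apply: filterS2 (embedB hj (state K B (f i) (theta + h)) (u i))
      (embedB hj (delta i h) (du i h)).
    by move=> x h1 h2 Dx; split; [rewrite /delta h1// [RHS]addrC subrK|exact: h2].
  apply: filterS2 (ae_fst E) (ae_snd E) => z E1 E2 Dz.
  rewrite /cov_map /cov /dcov /rho -!mulrBr -!sumrB; congr (_ * _).
  apply: eq_bigr => i _; have [-> ->] := E1 Dz i; have [-> ->] := E2 Dz i.
  by rewrite -/(u i) !rmorphD !rmorphN /=; ring.
Qed.
End CovarianceDerivative.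

(** * The adjoint state and the adjoint of the derivative *)

Section L2InnerProduct.
Context {R : realType} {disp : measure_display} {T : measurableType disp}.
Variables (mu : {measure set T -> \bar R}) (D : set T) (mD : measurable D).

Lemma L2ip_integrable (f g : T -> R[i]) : L2 mu D f -> L2 mu D g ->
  cintegrable mu D (fun x => f x * conjC (g x)).
Proof. by move=> f2 g2; apply: L2_cintegrableM => //; exact: L2_conj. Qed.

Lemma L2ip_conj (f g : T -> R[i]) : L2 mu D f -> L2 mu D g ->
  L2ip mu D g f = conjC (L2ip mu D f g).
Proof.
move=> f2 g2; rewrite /L2ip -cintegral_conj//; last exact: L2ip_integrable.
by apply: eq_cintegral => x _; rewrite rmorphM /= conjCK mulrC.
Qed.

Context {U : normedModType R[i]} (j : U -> T -> R[i]).
Hypothesis hj : L2_dense_embedding mu D j.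

Lemma L2form_subproof (g : T -> R[i]) : L2 mu D g ->
  bounded_semilinear (conjC \o idfun) (fun v => L2ip mu D g (j v) : (R[i])^o).
Proof.
move=> g2; have mg := L2_cmeasurable g2.
have mM v : cmeasurable D (fun x => g x * conjC (j v x)).
  exact/cmeasurableM/cmeasurable_conj/(embed_meas hj).
split=> [u v|a v|].
- rewrite /L2ip -cintegralD//; do ?exact/L2ip_integrable/(embed_L2 hj).
  apply: ae_eq_cintegral => //; first exact: cmeasurableD.
  by apply: filterS (embedD hj u v) => x h Dx; rewrite h// rmorphD mulrDr.
- rewrite /L2ip -[RHS]/(_ * _) -cintegralZ//; last exact/L2ip_integrable/(embed_L2 hj).
  apply: ae_eq_cintegral => //; first exact: cmeasurableZ.
  by apply: filterS (embedZ hj a v) => x h Dx; rewrite h// rmorphM mulrCA.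
- have [M M0 hM] := embed_sqint hj; have /L2P[_ gfin] := g2.
  (* The real and the imaginary part are each bounded by the L1 norm of the product, which explains
     the repeated summand. *)
  exists (fine (sqint mu D g) + M + (fine (sqint mu D g) + M)) => v v1.
  have v1' : complex.Re `|v| <= 1 by rewrite -lecR norm_ReK.
  have le : (l1norm mu D (fun x => (g x * conjC (j v x))%R) <=
      (fine (sqint mu D g) + M)%:E)%E.
    apply: le_trans (l1_mul_le mu mD mg (cmeasurable_conj (embed_meas hj v))) _.
    rewrite EFinD fineK ?ge0_fin_numE ?sqint_ge0//; apply: leeD => //.
    have -> : sqint mu D (fun x => conjC (j v x)) = sqint mu D (j v).
      by apply: eq_integral => x _; rewrite sqnorm_conj.
    apply: le_trans (hM v) _; rewrite lee_fin ler_piMr// expr_le1//.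
    exact: Re_norm_ge0.
  have [lr li] := l1norm_ge_Re mD (L2ip_integrable g2 (embed_L2 hj v)).
  by apply: normc_le_ReIm; rewrite -lee_fin; [exact: le_trans lr le|exact: le_trans li le].
Qed.

Definition L2form g (g2 : L2 mu D g) : cdual U := mk_bslin (L2form_subproof g2).

End L2InnerProduct.

(** The adjoint is linear in [w]: the antilinearity of [A e] and the conjugation in [adjoint_fun]
    cancel. *)
Lemma adjoint_sum {R : realType} {K : numFieldType} {s : {rmorphism K -> R[i]}}
    {E : normedModType K} {W : normedModType R[i]} (A : bslin s E (cdual W))
    (I : Type) (r : seq I) (a : I -> R[i]) (w : I -> W) e :
  adjoint A (\sum_(i <- r) a i *: w i) e = \sum_(i <- r) a i * adjoint A (w i) e.
Proof.
rewrite /= /adjoint_fun bslin_sum rmorph_sum; apply: eq_bigr => i _.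
by rewrite bslinZ /= rmorphM /= conjCK.
Qed.

Definition Psi_sum {R : realType} {T : Type} {W : normedModType R[i]} (n : nat)
    (ys : 'I_n -> T -> R[i]) (psi : 'I_n -> W) (x' : T) : W :=
  \sum_(i < n) conjC (ys i x') *: psi i.

Section AdjointState.
Context {R : realType} {disp : measure_display} {T : measurableType disp}.
Variables (mu : {sigma_finite_measure set T -> \bar R}) (D : set T).
Hypothesis mD : measurable D.
Local Notation mu2 := (mu \x mu)%E.
Local Notation D2 := (D `*` D).
Context {U : normedModType R[i]} {W : completeNormedModType R[i]}.
Context {X : normedModType R} (j : U -> T -> R[i]).
Hypothesis hj : L2_dense_embedding mu D j.
Variables (ip : {dot W for conjC}) (hip : hilbert_ip ip).
Variables (K : CLin U (cdual W)) (B : CLin U (RLin X (cdual W))).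
Variable (theta : X).
Hypothesis inv : boundedly_invertible (model K B theta).
Variables (y : T * T -> R[i]) (n : nat) (ys : 'I_n -> T -> R[i]).
Hypothesis my : cmeasurable D2 y.
Hypothesis ys2 : forall i, L2 mu D (ys i).
Hypothesis yE : {ae mu2, forall z, D2 z ->
  y z = \sum_(i < n) ys i z.1 * conjC (ys i z.2)}.

Lemma cmeasurable_section x' : D x' -> cmeasurable D (fun x => y (x, x')).
Proof.
move=> Dx'; have [y1 y2] := my; have mD2 := measurableX mD mD.
have mp : measurable_fun D (fun x : T => (x, x')).
  exact: measurable_funTS (pair2_measurable x').
by split; [apply: (measurable_comp mD2 _ y1 mp)|apply: (measurable_comp mD2 _ y2 mp)];
  move=> _ [x Dx <-].
Qed.

(** The exceptional $x'$ are those whose section of the null set in [yE] is not null, a set that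
    does not depend on [v]. The null sets in $x$ disappear under the integral. *)
Lemma ae_L2ip_section : {ae mu, forall x', D x' -> forall v : U,
  L2ip mu D (fun x => y (x, x')) (j v) =
    \sum_(i < n) conjC (ys i x') * L2ip mu D (ys i) (j v)}.
Proof.
apply: filterS (ae_section yE) => x' h Dx' v.
have iy i : cintegrable mu D (fun x => ys i x * conjC (j v x)).
  exact/L2ip_integrable/(embed_L2 hj).
rewrite /L2ip; under eq_bigr do rewrite -cintegralZ//.
rewrite -cintegral_sum//; last by move=> i; exact: cintegrableZ.
apply: ae_eq_cintegral => //.
- apply: cmeasurableM (cmeasurable_section Dx') _.
  exact/cmeasurable_conj/(embed_meas hj).
- by apply: cmeasurable_sum => i; apply: cmeasurableZ; exact: cintegrable_meas (iy i).
- apply: filterS (h Dx') => x hx Dx; rewrite hx// mulr_suml.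
  by apply: eq_bigr => i _ /=; rewrite mulrAC mulrC mulrA.
Qed.

Variable psi : 'I_n -> W.
Hypothesis psiE : forall i v, adjoint (model K B theta) (psi i) v = L2ip mu D (ys i) (j v).

Lemma adjoint_Psi_sum : {ae mu, forall x', D x' -> forall v : U,
  adjoint (model K B theta) (Psi_sum ys psi x') v = L2ip mu D (fun x => y (x, x')) (j v)}.
Proof.
apply: filterS ae_L2ip_section => x' h Dx' v; rewrite h// adjoint_sum.
by apply: eq_bigr => i _; rewrite psiE.
Qed.

Lemma extended_adjoint_state_Psi_sum :
  extended_adjoint_state mu D j K B theta y (Psi_sum ys psi).
Proof.
split; last exact: adjoint_Psi_sum.
by apply: bochner_L2_sum => // i; exact: L2_conj.
Qed.

Lemma extended_adjoint_state_unique Psi :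
  extended_adjoint_state mu D j K B theta y Psi ->
  {ae mu, forall x', D x' -> Psi x' = Psi_sum ys psi x'}.
Proof.
move=> [_ PsiE]; apply: filterS2 PsiE adjoint_Psi_sum => x' h h' Dx'.
by apply: (adjoint_inj hip inv); apply: bslinP0 => v; rewrite h// h'.
Qed.

End AdjointState.

(** * The integrand of the adjoint formula and its Bochner integral *)

Section Sensitivity.
Context {R : realType} {disp : measure_display} {T : measurableType disp}.
Variables (mu : {sigma_finite_measure set T -> \bar R}) (D : set T).
Hypothesis mD : measurable D.
Local Notation mu2 := (mu \x mu)%E.
Local Notation D2 := (D `*` D).
Context {U W : normedModType R[i]} {X : normedModType R} (j : U -> T -> R[i]).
Hypothesis hj : L2_dense_embedding mu D j.
Variables (B : CLin U (RLin X (cdual W))).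
Variables (J n : nat) (u : 'I_J -> U) (ys : 'I_n -> T -> R[i]) (psi : 'I_n -> W).
Hypothesis ys2 : forall i, L2 mu D (ys i).

(** For each fixed $x'$ the covariance section is a combination of the states with coefficients
    $\overline{u_k(x')}/J$, so it has an explicit preimage in [U]. Only the variable $x$ is subject
    to null sets, whence the identity at every $x'$. *)
Lemma B1cov_sum x' : B1cov mu D j B u x' =
  \sum_(k < J) (J%:R^-1 * conjC (j (u k) x')) *: B (u k).
Proof.
rewrite /B1cov (L2_liftE hj (u := \sum_(k < J) (J%:R^-1 * conjC (j (u k) x')) *: u k)).
  by rewrite bslin_sum; apply: eq_bigr => k _; rewrite bslinZ.
apply: filterS (embed_sum hj (index_enum _) (fun k => J%:R^-1 * conjC (j (u k) x')) u).
move=> x h Dx; rewrite h// /cov mulr_sumr; apply: eq_bigr => k _ /=.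
by rewrite -mulrA [conjC _ * _]mulrC.
Qed.

Let g k i x := J%:R^-1 * (j (u k) x * conjC (ys i x)).
Let zeta k i : rdual X := adjoint (B (u k)) (psi i).

Lemma g_cintegrable k i : cintegrable mu D (g k i).
Proof. by apply: cintegrableZ => //; apply: L2ip_integrable => //; exact: embed_L2 hj _. Qed.

(** Taking the adjoint conjugates the coefficient of [B (u k)], turning $\overline{u_k(x')}$ into
    $u_k(x')$, while the coefficient $\overline{y_i(x')}$ of [psi i] is kept; their product is the
    integrand of $(u_k, y_i)$. *)
Lemma adjoint_B1cov x' :
  (adjoint (B1cov mu D j B u x') (Psi_sum ys psi x') : rdual X) =
  \sum_(k < J) \sum_(i < n) g k i x' *: zeta k i.
Proof.
apply: bslinP0 => h; rewrite adjoint_sum sum_bslinE.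
under [RHS]eq_bigr do rewrite sum_bslinE.
rewrite [RHS]exchange_big; apply: eq_bigr => i _.
rewrite /= /adjoint_fun B1cov_sum !sum_bslinE rmorph_sum mulr_sumr.
apply: eq_bigr => k _; rewrite !scalebslinE /= /adjoint_fun /g.
rewrite -![_ *: _]/(_ * _) !rmorphM /= conjCK.
rewrite fmorphV rmorph_nat.
rewrite -[RHS]/(J%:R^-1 * (j (u k) x' * conjC (ys i x')) * conjC (B (u k) h (psi i))).
by ring.
Qed.

Definition sensitivity : rdual X :=
  \sum_(k < J) \sum_(i < n) cintegral mu D (g k i) *: zeta k i.

Lemma is_bochner_sensitivity Psi : {ae mu, forall x', D x' -> Psi x' = Psi_sum ys psi x'} ->
  is_bochner_integral mu D
    (fun x' => adjoint (B1cov mu D j B u x') (Psi x') : rdual X) sensitivity.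
Proof.
move=> PsiE.
apply: (is_bochner_integral_ae (g := fun x' => \sum_(k < J) \sum_(i < n) g k i x' *: zeta k i)).
  by apply: filterS PsiE => x' h Dx'; rewrite h// adjoint_B1cov.
apply: is_bochner_integral_sum => // k; apply: is_bochner_integral_sum => // i.
by apply: is_bochner_integralZ => //; exact: g_cintegrable.
Qed.

(** [is_bochner_sensitivity] shows that the choice in [bochner_integral] is made from a nonempty
    set, and evaluation at [h] gives every member of that set the same value. *)
Lemma bochner_integral_sensitivity Psi h : {ae mu, forall x', D x' -> Psi x' = Psi_sum ys psi x'} ->
  bochner_integral mu D
    (fun x' => adjoint (B1cov mu D j B u x') (Psi x') : rdual X) h =
  \sum_(k < J) \sum_(i < n) J%:R^-1 * L2ip mu D (j (u k)) (ys i) * zeta k i h.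
Proof.
move=> PsiE; set G := fun x' : T => _.
have GI := is_bochner_sensitivity PsiE.
have GI' : is_bochner_integral mu D G (bochner_integral mu D G).
  by apply: (@getPex _ [set I | is_bochner_integral mu D G I]); exists sensitivity.
pose gam x := \sum_(k < J) \sum_(i < n) g k i x * zeta k i h.
have igam : cintegrable mu D gam.
  apply: cintegrable_sum => // k; apply: cintegrable_sum => // i.
  under eq_fun do rewrite mulrC; apply: cintegrableZ => //; exact: g_cintegrable.
rewrite (is_bochner_integral_eval mD (h := h) GI' igam); last first.
  apply: filterS PsiE => x' hx Dx'; rewrite /G hx// adjoint_B1cov sum_bslinE.
  by apply: eq_bigr => k _; rewrite sum_bslinE.
have iz k i : cintegrable mu D (fun x => zeta k i h * g k i x).
  by apply: cintegrableZ => //; exact: g_cintegrable.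
rewrite cintegral_sum//; last first.
  move=> k; apply: cintegrable_sum => // i; under eq_fun do rewrite mulrC; exact: iz.
apply: eq_bigr => k _; rewrite cintegral_sum//; last first.
  by move=> i; under eq_fun do rewrite mulrC; exact: iz.
apply: eq_bigr => i _; under eq_cintegral do rewrite mulrC.
rewrite cintegralZ//; last exact: g_cintegrable.
rewrite mulrC cintegralZ//; apply: L2ip_integrable => //; exact: embed_L2 hj _.
Qed.

End Sensitivity.

(** * The representer in [X], the pairing on the covariance cone, and the adjoint formula *)

Lemma riesz_ReP (R : realType) (X : completeNormedModType R)
    (ip : {dot X for idfun}) (xi : rdual X) h : hilbert_ip ip ->
  ip h (riesz ip (Re_form xi)) = Re_form xi h.
Proof.
move=> hip; apply: (@getPex _ [set z | forall h, ip h z = Re_form xi h]).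
apply: (riesz_real (M := opnorm xi) hip).
  move=> a v w; rewrite /Re_form bslinD bslinZ ReD /= -[_ *: _]/(_ * _) ReM Re_conjC Im_conjC /=.
  by rewrite oppr0 mul0r subr0.
move=> v; apply: le_trans (ler_Re_norm _) _.
rewrite -lecR Re_normcK; apply: le_trans (bslin_le xi v) _.
rewrite mulrC /= norm_conjC.
have -> : `|(`|v|)%:C| = (`|v|)%:C :> R[i] by rewrite ger0_norm// ler0c.
by rewrite real_complexM.
Qed.

(** Conjugating the finite-rank term leaves $\overline{y_i(x)}\,y_i(x')$; regrouping by variable, as
    in [P], makes each summand a tensor product to which Fubini applies. *)
Lemma L2ip_cov {R : realType} {disp : measure_display} {T : measurableType disp}
    (mu : {sigma_finite_measure set T -> \bar R}) (D : set T) (J n : nat)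
    (a b : 'I_J -> T -> R[i]) (ys : 'I_n -> T -> R[i]) (c : R[i]) : measurable D ->
  (forall k, L2 mu D (a k)) -> (forall k, L2 mu D (b k)) ->
  (forall i, L2 mu D (ys i)) ->
  L2ip (mu \x mu)%E (D `*` D)
    (fun z => c * \sum_(k < J) (a k z.1 * conjC (b k z.2) + b k z.1 * conjC (a k z.2)))
    (fun z => \sum_(i < n) ys i z.1 * conjC (ys i z.2)) =
  \sum_(k < J) \sum_(i < n)
    c * (L2ip mu D (a k) (ys i) * conjC (L2ip mu D (b k) (ys i)) +
         L2ip mu D (b k) (ys i) * conjC (L2ip mu D (a k) (ys i))).
Proof.
move=> mD a2 b2 ys2; have mD2 := measurableX mD mD.
pose P (f g : T -> R[i]) i (z : T * T) :=
  (f z.1 * conjC (ys i z.1)) * (ys i z.2 * conjC (g z.2)).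
have iP (f g : T -> R[i]) i : L2 mu D f -> L2 mu D g ->
    cintegrable (mu \x mu)%E (D `*` D) (P f g i).
  move=> f2 g2.
  by apply: (cintegrable_tensor mD (L2ip_integrable mD f2 (ys2 i)) (L2ip_integrable mD (ys2 i) g2)).
have PE (f g : T -> R[i]) i : L2 mu D f -> L2 mu D g ->
    cintegral (mu \x mu)%E (D `*` D) (P f g i) =
      L2ip mu D f (ys i) * conjC (L2ip mu D g (ys i)).
  move=> f2 g2; rewrite -L2ip_conj//.
  exact: (cintegral_tensor mD (L2ip_integrable mD f2 (ys2 i)) (L2ip_integrable mD (ys2 i) g2)).
rewrite /L2ip (eq_cintegral _ (g := fun z => \sum_(k < J) \sum_(i < n)
    c * (P (a k) (b k) i z + P (b k) (a k) i z))); last first.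
  move=> z _; rewrite mulr_sumr mulr_suml; apply: eq_bigr => k _.
  rewrite rmorph_sum mulr_sumr; apply: eq_bigr => i _ /=.
  by rewrite rmorphM /= conjCK /P; ring.
have iQ k i : cintegrable (mu \x mu)%E (D `*` D) (fun z => P (a k) (b k) i z + P (b k) (a k) i z).
  by apply: cintegrableD => //; exact: iP.
rewrite cintegral_sum//; last by move=> k; apply: cintegrable_sum => // i; exact: cintegrableZ.
apply: eq_bigr => k _; rewrite cintegral_sum//; last by move=> i; exact: cintegrableZ.
apply: eq_bigr => i _; rewrite cintegralZ// cintegralD//; try exact: iP.
by rewrite !PE.
Qed.

Theorem theorem3p5 (R : realType)
    (d : nat) (Omega : set 'rV[R]_d) (hOmega : smooth_domain Omega)
    (U W : completeNormedModType R[i])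
    (ipU : {dot U for conjC}) (hU : hilbert_ip ipU)
    (ipW : {dot W for conjC}) (hW : hilbert_ip ipW)
    (jU : U -> 'rV[R]_d -> R[i])
    (hjU : L2_dense_embedding (lebesgue_rV d) Omega jU)
    (jW : W -> 'rV[R]_d -> R[i])
    (hjW : L2_dense_embedding (lebesgue_rV d) Omega jW)
    (X H : completeNormedModType R)
    (ipX : {dot X for idfun}) (hX : hilbert_ip ipX)
    (ipH : {dot H for idfun}) (hH : hilbert_ip ipH)
    (jX : {linear X -> H}) (jX_continuous : continuous jX)
    (jX_injective : injective jX) (jX_dense : dense (range jX))
    (K : CLin U (cdual W)) (B : CLin U (RLin X (cdual W)))
    (DD : set X) (DD_open : open DD)
    (hDD : forall eta, DD eta -> boundedly_invertible (model K B eta))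
    (J : nat) (J_gt0 : (0 < J)%N) (f : 'I_J -> cdual W)
    (theta : X) (htheta : DD theta) :
  let mu := lebesgue_rV d in
  let mu2 := (mu \x mu)%E in
  let Omega2 := Omega `*` Omega in
  let u (j : 'I_J) : U := state K B (f j) theta in
  let F : X -> 'rV[R]_d * 'rV[R]_d -> R[i] := cov_map jU K B f in
  (forall eta, DD eta -> L2 mu2 Omega2 (F eta)) /\
  (exists dF, frechet_L2 mu2 Omega2 DD F theta dF) /\
  forall dF, frechet_L2 mu2 Omega2 DD F theta dF ->
  forall y, cov_cone mu Omega y ->
    (exists Psi, extended_adjoint_state mu Omega jU K B theta y Psi) /\
    forall Psi, extended_adjoint_state mu Omega jU K B theta y Psi ->
      let G (x' : 'rV[R]_d) : rdual X :=
        adjoint (B1cov mu Omega jU B u x') (Psi x') in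
      bochner_integrable mu Omega G /\
      forall h : X,
        L2ip mu2 Omega2 (dF h) y =
        (ipX h (- 2 *: riesz ipX (Re_form (bochner_integral mu Omega G))))%:C.
Proof.
move=> mu mu2 Omega2 u F.
have mO : measurable Omega by apply: open_measurable_rV; case: hOmega.
have mO2 : measurable Omega2 by exact: measurableX.
have inv := hDD _ htheta; have [A' [A'K AK]] := inv.
have F2 eta : L2 mu2 Omega2 (F eta) by exact: L2_cov_map.
have dP := frechet_dcov mO hjU hDD f A'K AK.
split=> [eta _|]; first exact: F2.
split=> [|dF dFP y [y2 [n [ys [ys2 yE]]]]].
  by exists (dcov jU K B f theta A').
have my := L2_cmeasurable y2.
have /choice[psi psiE] i : exists w, forall v,
    adjoint (model K B theta) w v = L2ip mu Omega (ys i) (jU v).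
  have [w wE] := adjoint_onto hW inv (L2form mO hjU (ys2 i)).
  by exists w => v; rewrite wE.
split; first by exists (Psi_sum ys psi); exact: extended_adjoint_state_Psi_sum.
move=> Psi PsiP G.
have PsiE := extended_adjoint_state_unique mO hjU hW inv my ys2 yE psiE PsiP.
split; first by exists (sensitivity mu Omega jU B u ys psi); exact: is_bochner_sensitivity.
move=> h; rewrite linearZr_LR /= riesz_ReP// /Re_form.
have -> : bochner_integral mu Omega G h = \sum_(k < J) \sum_(i < n)
    J%:R^-1 * L2ip mu Omega (jU (u k)) (ys i) * adjoint (B (u k)) (psi i) h.
  exact: bochner_integral_sensitivity.
(* An arbitrary derivative agrees with [dcov] almost everywhere, and [y] with its finite sum, so
   explicit functions may be paired instead. *)
have -> : L2ip mu2 Omega2 (dF h) y = L2ip mu2 Omega2 (dcov jU K B f theta A' h)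
    (fun z => \sum_(i < n) ys i z.1 * conjC (ys i z.2)).
  have mys : cmeasurable Omega2 (fun z => \sum_(i < n) ys i z.1 * conjC (ys i z.2)).
    apply: cmeasurable_sum => i; apply: L2_cmeasurable.
    by apply: (L2_tensor mO (ys2 i) (L2_conj (ys2 i))).
  have [dF2 _ _ _] := dFP; have [d2 _ _ _] := dP.
  apply: ae_eq_cintegral => //.
  - by apply: cmeasurableM; [exact: L2_cmeasurable (dF2 h)|exact: cmeasurable_conj].
  - by apply: cmeasurableM; [exact: L2_cmeasurable (d2 h)|exact: cmeasurable_conj].
  - have ae := frechet_L2_unique mO2 DD_open htheta (fun eta _ => L2_cmeasurable (F2 eta)) dFP dP h.
    by apply: filterS2 ae yE => z h1 h2 Dz; rewrite h1// h2.
pose a k i := L2ip mu Omega (jU (u k)) (ys i).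
(* The two adjoint problems meet: $D(\theta)\,du_k = -B(u_k)h$ is paired with [psi i], and the
   equation for [psi i] trades this for the L2 pairing of $du_k$ with [ys i]. *)
have dual k i : adjoint (B (u k)) (psi i) h =
    - conjC (L2ip mu Omega (jU (dstate B A' (u k) h)) (ys i)).
  rewrite -L2ip_conj//; last exact: embed_L2 hjU _.
  rewrite -psiE /adjoint /= /adjoint_fun.
  by rewrite model_dstate// oppbslinE rmorphN opprK.
apply: etrans (@L2ip_cov R _ _ mu Omega J n (fun k => jU (dstate B A' (u k) h))
  (fun k => jU (u k)) ys J%:R^-1 mO (fun k => embed_L2 hjU _) (fun k => embed_L2 hjU _) ys2) _.
pose b k i := L2ip mu Omega (jU (dstate B A' (u k) h)) (ys i).
pose S := \sum_(k < J) \sum_(i < n) J%:R^-1 * (a k i * conjC (b k i)).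
(* The two halves of the product rule contribute conjugate terms, [J%:R^-1] being real. *)
transitivity (S + conjC S).
  rewrite /S rmorph_sum -big_split; apply: eq_bigr => k _ /=.
  rewrite rmorph_sum -big_split; apply: eq_bigr => i _ /=.
  rewrite !rmorphM /= fmorphV rmorph_nat conjCK -/(a k i) -/(b k i).
  by ring.
have -> : \sum_(k < J) \sum_(i < n)
    J%:R^-1 * L2ip mu Omega (jU (u k)) (ys i) * adjoint (B (u k)) (psi i) h = - S.
  rewrite /S -sumrN; apply: eq_bigr => k _; rewrite -sumrN; apply: eq_bigr => i _.
  by rewrite dual mulrN mulrA.
(* [S + conjC S] is real, as an inner product in [X] must be, and $2\,\mathrm{Re}\,S =
   -2\,\mathrm{Re}(-S)$ accounts for the factor in the formula. *)
apply: complexP; rewrite /= ?(ReD, ImD, Re_conjC, Im_conjC, ReN, subrr)//.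
by ring.
Qed.
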